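(* Suppose the primal SDP (P) and dual SDP (D) given by the data $(\mathcal A,b,C)$ satisfy the regularity assumptions (see context). Let $X_\star$ be the primal solution, $y_\star$ the dual solution, $r_\star=\operatorname{rank}(X_\star)$, and set $r=r_\star$. Then there is a constant $c_1>0$, depending only on $\mathcal A$, $b$ and $C$, such that the following holds. Let $y\in\mathbb R^m$ be feasible for (D) with suboptimality $\epsilon:=b^\top y_\star-b^\top y<c_1$. Let $V\in\mathbb R^{n\times r}$ have orthonormal columns whose span is an $r$-dimensional invariant subspace of $Z(y)$ associated with its $r$ smallest eigenvalues, let $\hat S$ be a solution of $$\text{minimize}\ \ \tfrac12\|\mathcal A(VSV^\top)-b\|_2^2\quad\text{subject to}\quad S\in\mathbb S^r,\ S\succeq0,$$ and put $X_{\mathrm{infeas}}=V\hat SV^\top$. Then $$T:=\lambda_{n-r}(Z(y))\ \ge\ \tfrac12\lambda_{n-r}(Z(y_\star))>0$$ and $$\|X_{\mathrm{infeas}}-X_\star\|_F\ \le\ (1+2\kappa)\left(\frac{\epsilon}{T}+\sqrt{2\,\frac{\epsilon}{T}\,\|X_\star\|_{\mathrm{op}}}\right).$$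
   Context: $\mathbb S^n$ is the space of real symmetric $n\times n$ matrices and $\succeq 0$ means positive semidefinite. Data: $C\in\mathbb S^n$, $b\in\mathbb R^m$, and a linear map $\mathcal A:\mathbb R^{n\times n}\to\mathbb R^m$ of rank $m$, $[\mathcal A H]_i=\operatorname{tr}(A_iH)$ with $A_i\in\mathbb S^n$; $\mathcal A^\top$ is its adjoint. (P): minimize $\operatorname{tr}(CX)$ subject to $\mathcal A X=b$, $X\succeq0$ ($X\in\mathbb S^n$). (D): maximize $b^\top y$ subject to $C-\mathcal A^\top y\succeq0$ ($y\in\mathbb R^m$). Slack matrix: $Z(y):=C-\mathcal A^\top y$. Regularity assumptions: (i) (P) has a solution; (ii) (D) has a unique solution $y_\star$; (iii) strong duality: $\operatorname{tr}(CX_\star)=b^\top y_\star$; (iv) strict complementarity: every pair of a primal solution $X_\star$ and dual solution $y_\star$ satisfies $\operatorname{rank}(X_\star)+\operatorname{rank}(Z(y_\star))=n$. (These imply that the primal solution $X_\star$ is unique.) $\lambda_i(\cdot)$ is the $i$-th largest eigenvalue; $\|\cdot\|_F$ is the Frobenius norm and $\|\cdot\|_{\mathrm{op}}$ the $\ell_2$ operator norm. Expressions $\lambda_{n-r}$ presuppose $r<n$. Let $V_\star\in\mathbb R^{n\times r_\star}$ be an orthonormal matrix whose columns span $\operatorname{range}(X_\star)$, and $\mathcal A_{V_\star}(S):=\mathcal A(V_\star SV_\star^\top)$ for $S\in\mathbb S^{r_\star}$. Define $\sigma_{\max}(\mathcal A)=\max_{\|H\|_F=1}\|\mathcal A H\|_2$,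 $\sigma_{\min}(\mathcal A_{V_\star})=\min_{S\in\mathbb S^{r_\star},\|S\|_F=1}\|\mathcal A_{V_\star}(S)\|_2$, and $\kappa:=\sigma_{\max}(\mathcal A)/\sigma_{\min}(\mathcal A_{V_\star})$. *)

(* Defs.v *)
From HB Require Import structures.
From mathcomp Require Import all_boot all_order all_algebra.
From mathcomp Require Import classical_sets reals.
Set Implicit Arguments.
Unset Strict Implicit.
Unset Printing Implicit Defensive.
Import Order.TTheory GRing.Theory Num.Theory.
Local Open Scope classical_set_scope.
Local Open Scope ring_scope.

Section Matrices.
Variable R : realType.

(* On column vectors this is the Euclidean norm. *)
Definition normF (p q : nat) (H : 'M[R]_(p, q)) : R :=
  Num.sqrt (\sum_i \sum_j H i j ^+ 2).

Definition normop (p q : nat) (M : 'M[R]_(p, q)) : R :=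
  sup [set normF (M *m x) | x in [set x : 'cV[R]_q | normF x <= 1]].

Definition dot (p : nat) (u v : 'cV[R]_p) : R := (u^T *m v) 0 0.

Definition psd (p : nat) (M : 'M[R]_p) : Prop :=
  M \is symmetricmx /\ forall x : 'cV[R]_p, 0 <= dot x (M *m x).

Definition is_spectrum (p : nat) (M : 'M[R]_p) (s : seq R) : Prop :=
  sorted >=%R s /\ char_poly M = \prod_(x <- s) ('X - x%:P).

(* The eigenvalues with multiplicity, in decreasing order. There is at most one
   such sequence, and there is one when M is symmetric; [::] is a junk value. *)
Definition spectrum (p : nat) (M : 'M[R]_p) : seq R :=
  xget [::] [set s | is_spectrum M s].

(* The i-th largest eigenvalue, counted from i = 1. *)
Definition lambda (p : nat) (i : nat) (M : 'M[R]_p) : R :=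
  nth 0 (spectrum M) i.-1.

Definition orthonormal_cols (p q : nat) (V : 'M[R]_(p, q)) : Prop :=
  V^T *m V = 1%:M.

(* The column space of V is invariant under M. V^T *m M *m V is then the matrix
   in the basis V of the restriction of M, and its eigenvalues are required to
   be the q smallest eigenvalues of M. *)
Definition smallest_eigenbasis (p q : nat) (M : 'M[R]_p) (V : 'M[R]_(p, q)) :
    Prop :=
  [/\ orthonormal_cols V,
      M *m V = V *m (V^T *m M *m V) &
      spectrum (V^T *m M *m V) = drop (p - q) (spectrum M)].

(* mxalgebra's %MS relations compare row spaces, hence the transposes. *)
Definition range_basis (p q : nat) (X : 'M[R]_p) (V : 'M[R]_(p, q)) : Prop :=
  orthonormal_cols V /\ (V^T == X^T)%MS.

End Matrices.

Section SDP.
Variables (R : realType) (n m : nat).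
Variables (A : 'I_m -> 'M[R]_n) (b : 'cV[R]_m) (C : 'M[R]_n).

Definition calA (H : 'M[R]_n) : 'cV[R]_m := \col_i \tr (A i *m H).

(* The adjoint of calA for the trace inner product, the A i being symmetric. *)
Definition calAT (y : 'cV[R]_m) : 'M[R]_n := \sum_i y i 0 *: A i.

Definition sdp_data : Prop :=
  [/\ forall i, A i \is symmetricmx,
      C \is symmetricmx &
      \rank (lin_mx calA) = m].

Definition primal_feasible (X : 'M[R]_n) : Prop := calA X = b /\ psd X.

Definition primal_solution (X : 'M[R]_n) : Prop :=
  primal_feasible X /\
  forall X', primal_feasible X' -> \tr (C *m X) <= \tr (C *m X').

Definition slack (y : 'cV[R]_m) : 'M[R]_n := C - calAT y.

Definition dual_feasible (y : 'cV[R]_m) : Prop := psd (slack y).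

Definition dual_solution (y : 'cV[R]_m) : Prop :=
  dual_feasible y /\ forall y', dual_feasible y' -> dot b y' <= dot b y.

Definition regular : Prop :=
  [/\ exists X, primal_solution X,
      exists! y, dual_solution y,
      forall X y, primal_solution X -> dual_solution y ->
        \tr (C *m X) = dot b y &
      forall X y, primal_solution X -> dual_solution y ->
        (\rank X + \rank (slack y))%N = n].

Definition sigma_max : R :=
  sup [set normF (calA H) | H in [set H : 'M[R]_n | normF H = 1]].

Definition compress (r : nat) (V : 'M[R]_(n, r)) (S : 'M[R]_r) : 'cV[R]_m :=
  calA (V *m S *m V^T).

(* Both extrema are attained when their index sets are nonempty. For r = 0 the
   infimum is over the empty set, and is 0. *)
Definition sigma_min (r : nat) (V : 'M[R]_(n, r)) : R :=
  inf [set normF (compress V S) |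
       S in [set S : 'M[R]_r | S \is symmetricmx /\ normF S = 1]].

Definition kappa (r : nat) (V : 'M[R]_(n, r)) : R := sigma_max / sigma_min V.

Definition compressed_objective (r : nat) (V : 'M[R]_(n, r)) (S : 'M[R]_r) : R :=
  2^-1 * normF (compress V S - b) ^+ 2.

Definition compressed_solution (r : nat) (V : 'M[R]_(n, r)) (S : 'M[R]_r) :
    Prop :=
  psd S /\
  forall S', psd S' -> compressed_objective V S <= compressed_objective V S'.

End SDP.

(* Main.v *)
(* The proof is finite-dimensional linear algebra; no compactness is used.

   Let X, y0 be the solutions, Z0 = slack y0, and P0 the projector onto range X,
   which by strict complementarity is the projector onto ker Z0. Uniqueness of
   y0 makes d |-> A^T(d) P0 injective on range A^T, and strict complementarity
   makes the operator A injective on the symmetric H = P0 H P0; linear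
   injectivity then gives quantitative bounds. For a feasible y, the identity
   tr(Z X) = eps for Z = slack y controls Z P0, hence Z - Z0, and T is bounded
   below by Weyl's inequality.

   Let P = V V^T. As Z >= T (1 - P), tr((1 - P) X) <= eps / T, which bounds
   X - P X P by the parenthesis delta of the statement; it also bounds
   (1 - P0) P, so that sigma_min A_V >= sigma_min A_Vs / 2. Finally, the
   residual of the compressed problem is a projection onto a convex cone, and
   projections are nonexpansive: with S' = V^T X V,
   |A_V (S' - S)| <= |A_V S' - b| <= sigma_max A * delta. *)
Require Import Defs.
From HB Require Import structures.
From mathcomp Require Import all_boot all_order all_algebra.
From mathcomp Require Import classical_sets reals.
From mathcomp Require Import complex perm ring lra zify.
Import Order.TTheory GRing.Theory Num.Theory.
Local Open Scope ring_scope.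

(** * Frobenius norm and the trace inner product *)

Section FrobeniusNorm.
Set Implicit Arguments.
Unset Strict Implicit.
Variable R : realType.

Lemma symmetricmxP (n : nat) (M : 'M[R]_n) : reflect (M^T = M) (M \is symmetricmx).
Proof.
apply: (iffP (is_hermitianmxP _ _ _)); rewrite expr0 scale1r map_mx_id //.
Qed.

Lemma trmxD (p q : nat) (A B : 'M[R]_(p, q)) : (A + B)^T = A^T + B^T.
Proof. exact: linearD. Qed.

Lemma trmxN (p q : nat) (A : 'M[R]_(p, q)) : (- A)^T = - A^T.
Proof. exact: linearN. Qed.

Lemma trmxB (p q : nat) (A B : 'M[R]_(p, q)) : (A - B)^T = A^T - B^T.
Proof. exact: linearB. Qed.

Lemma trmxZ (p q : nat) (a : R) (A : 'M[R]_(p, q)) : (a *: A)^T = a *: A^T.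
Proof. exact: linearZ. Qed.

Lemma mxtraceN (p : nat) (A : 'M[R]_p) : \tr (- A) = - \tr A.
Proof. exact: linearN. Qed.

Lemma mxtraceB (p : nat) (A B : 'M[R]_p) : \tr (A - B) = \tr A - \tr B.
Proof. exact: linearB. Qed.

Lemma trmulmxE (p q : nat) (A B : 'M[R]_(p, q)) :
  \tr (A^T *m B) = \sum_i \sum_j A i j * B i j.
Proof.
rewrite /mxtrace exchange_big /=; apply: eq_bigr => j _.
by rewrite mxE; apply: eq_bigr => i _; rewrite mxE.
Qed.

Lemma sumsq_ge0 (p q : nat) (H : 'M[R]_(p, q)) :
  0 <= \sum_i \sum_j H i j ^+ 2.
Proof. by apply: sumr_ge0 => i _; apply: sumr_ge0 => j _; apply: sqr_ge0. Qed.

Lemma normF_sqr (p q : nat) (H : 'M[R]_(p, q)) : normF H ^+ 2 = \tr (H^T *m H).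
Proof.
rewrite /normF sqr_sqrtr ?sumsq_ge0 // trmulmxE.
by apply: eq_bigr => i _; apply: eq_bigr.
Qed.

Lemma normF_ge0 (p q : nat) (H : 'M[R]_(p, q)) : 0 <= normF H.
Proof. exact: sqrtr_ge0. Qed.

Lemma normF_eq0 (p q : nat) (H : 'M[R]_(p, q)) : normF H = 0 -> H = 0.
Proof.
move/eqP; rewrite sqrtr_eq0 => h; apply/matrixP => i j; rewrite mxE.
have h0 : \sum_i \sum_j H i j ^+ 2 == 0 by rewrite eq_le h sumsq_ge0.
move: h0; rewrite psumr_eq0; last first.
  by move=> k _; apply: sumr_ge0 => l _; apply: sqr_ge0.
move/allP/(_ i (mem_index_enum i)) => /=.
rewrite psumr_eq0; last by move=> l _; apply: sqr_ge0.
by move/allP/(_ j (mem_index_enum j)); rewrite /= sqrf_eq0 => /eqP.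
Qed.

Lemma normF0 (p q : nat) : normF (0 : 'M[R]_(p, q)) = 0.
Proof. by apply/eqP; rewrite -sqrf_eq0 normF_sqr mulmx0 mxtrace0. Qed.

Lemma normF_gt0 (p q : nat) (H : 'M[R]_(p, q)) : H != 0 -> 0 < normF H.
Proof.
move=> H0; rewrite lt_neqAle normF_ge0 andbT eq_sym.
by apply: contra H0 => /eqP /normF_eq0 /eqP.
Qed.

Lemma normF_leP (p q : nat) (H : 'M[R]_(p, q)) (a : R) :
  0 <= a -> normF H ^+ 2 <= a ^+ 2 -> normF H <= a.
Proof. by move=> a0; rewrite ler_sqr // nnegrE ?normF_ge0. Qed.

Lemma normFZ (p q : nat) (a : R) (H : 'M[R]_(p, q)) :
  normF (a *: H) = `|a| * normF H.
Proof.
apply/eqP; rewrite -(@eqrXn2 _ 2) ?mulr_ge0 ?normF_ge0 //.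
rewrite exprMn !normF_sqr trmxZ -scalemxAr -scalemxAl !mxtraceZ.
by rewrite real_normK ?num_real // expr2 mulrA.
Qed.

Lemma normFN (p q : nat) (H : 'M[R]_(p, q)) : normF (- H) = normF H.
Proof. by rewrite -scaleN1r normFZ normrN1 mul1r. Qed.

Lemma normF_tr (p q : nat) (H : 'M[R]_(p, q)) : normF H^T = normF H.
Proof.
apply/eqP; rewrite -(@eqrXn2 _ 2) ?normF_ge0 //.
by rewrite !normF_sqr trmxK mxtrace_mulC.
Qed.

Lemma trmulmx_sym (p q : nat) (A B : 'M[R]_(p, q)) :
  \tr (A^T *m B) = \tr (B^T *m A).
Proof. by rewrite -mxtrace_tr trmx_mul trmxK. Qed.

Lemma normF_sqrD (p q : nat) (A B : 'M[R]_(p, q)) :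
  normF (A + B) ^+ 2 = normF A ^+ 2 + 2 * \tr (A^T *m B) + normF B ^+ 2.
Proof.
rewrite !normF_sqr trmxD mulmxDl !mulmxDr !mxtraceD.
by rewrite (trmulmx_sym B A); ring.
Qed.

(** Cauchy-Schwarz: expand the squared norm of [normF B *: A - normF A *: B], which is
    nonnegative. *)
Lemma trmulmx_le (p q : nat) (A B : 'M[R]_(p, q)) :
  \tr (A^T *m B) <= normF A * normF B.
Proof.
have [->|B0] := eqVneq B 0; first by rewrite mulmx0 mxtrace0 normF0 mulr0.
have [->|A0] := eqVneq A 0; first by rewrite trmx0 mul0mx mxtrace0 normF0 mul0r.
have a0 := normF_gt0 A0; have b0 := normF_gt0 B0.
have := sqr_ge0 (normF (normF B *: A + (- normF A) *: B)).
rewrite normF_sqrD !normFZ normrN !ger0_norm ?normF_ge0 //.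
rewrite trmxZ -scalemxAl -scalemxAr !mxtraceZ.
have ab0 : 0 < normF A * normF B by apply: mulr_gt0.
set t := \tr _; set a := normF A in a0 ab0 *; set b := normF B in b0 ab0 *.
move=> h; rewrite -subr_ge0 -(pmulr_rge0 _ ab0).
have -> : a * b * (a * b - t) = ((b * a) ^+ 2 + 2 * (b * (- a * t)) + (a * b) ^+ 2) / 2.
  by field.
by rewrite divr_ge0.
Qed.

Lemma trmulmx_sqr_le (p q : nat) (A B : 'M[R]_(p, q)) :
  \tr (A^T *m B) ^+ 2 <= normF A ^+ 2 * normF B ^+ 2.
Proof.
rewrite -exprMn -real_normK ?num_real // ler_sqr ?nnegrE ?mulr_ge0 ?normF_ge0 //.
rewrite ler_norml trmulmx_le andbT lerNl.
by have := trmulmx_le (- A) B; rewrite normFN trmxN mulNmx mxtraceN.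
Qed.

Lemma normFD (p q : nat) (A B : 'M[R]_(p, q)) : normF (A + B) <= normF A + normF B.
Proof.
apply: normF_leP; first by rewrite addr_ge0 ?normF_ge0.
rewrite normF_sqrD; have := trmulmx_le A B; nra.
Qed.

Lemma normFB (p q : nat) (A B : 'M[R]_(p, q)) : normF (A - B) <= normF A + normF B.
Proof. by rewrite -(normFN B); apply: normFD. Qed.

(** Cauchy-Schwarz for each entry of the product, between a row of [A] and a column of [B], then
    summation. *)
Lemma normFM (p q k : nat) (A : 'M[R]_(p, q)) (B : 'M[R]_(q, k)) :
  normF (A *m B) <= normF A * normF B.
Proof.
apply: normF_leP; first by rewrite mulr_ge0 ?normF_ge0.
rewrite exprMn -(normF_tr A) !normF_sqr !trmulmxE.
rewrite [X in _ <= X * _]exchange_big /=.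
rewrite [X in _ <= _ * X]exchange_big /=.
rewrite mulr_suml; apply: ler_sum => i _; rewrite mulr_sumr; apply: ler_sum => j _.
have := trmulmx_sqr_le (row i A)^T (col j B).
have -> : \tr ((row i A)^T^T *m col j B) = (A *m B) i j.
  by rewrite trmxK trace_mx11 !mxE; apply: eq_bigr => l _; rewrite !mxE.
rewrite !normF_sqr !trmulmxE.
rewrite (eq_bigr (fun l => A^T l i * A^T l i)); last first.
  by move=> l _; rewrite big_ord1 !mxE.
rewrite [X in _ * X](eq_bigr (fun l => B l j * B l j)) //.
by move=> l _; rewrite big_ord1 !mxE.
Qed.

Lemma dot_tr (p : nat) (u v : 'cV[R]_p) : dot u v = \tr (u^T *m v).
Proof. by rewrite /dot trace_mx11. Qed.

End FrobeniusNorm.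

(** * Spectral theorem for real symmetric matrices, and Weyl's inequality *)

Section Spectral.
Set Implicit Arguments.
Unset Strict Implicit.
Variable R : realType.

(** One column at a time: as long as [row_mx B U] has rank below [n], its left kernel contains a
    nonzero vector, which is normalized and added to [U]. *)
Lemma orthonormal_extension (n q k : nat) (B : 'M[R]_(n, q)) :
  (\rank B + k <= n)%N -> exists U : 'M[R]_(n, k), U^T *m U = 1%:M /\ B^T *m U = 0.
Proof.
elim: k => [_|k IHk Bk].
  by exists 0; split; [rewrite [LHS]flatmx0 [RHS]flatmx0 | rewrite mulmx0].
have [|U [UU BU]] := IHk; first by apply: leq_trans Bk; rewrite leq_add2l.
have rkQ : (\rank (row_mx B U) < n)%N.
  apply: leq_trans Bk; rewrite addnS ltnS -mxrank_tr tr_row_mx.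
  rewrite -addsmxE (leq_trans (mxrank_adds_leqif _ _)) //.
  by rewrite !mxrank_tr leq_add2l rank_leq_col.
have : kermx (row_mx B U) != 0.
  by rewrite -mxrank_eq0 mxrank_ker subn_eq0 -ltnNge.
case/rowV0Pn => w /sub_kermxP wQ w0.
pose x := (normF w)^-1 *: w^T.
have nw0 : normF w != 0 by rewrite gt_eqF ?normF_gt0.
have xx : x^T *m x = 1%:M.
  rewrite [LHS]mx11_scalar; congr (_%:M).
  rewrite -trace_mx11 -normF_sqr normFZ normF_tr ger0_norm ?invr_ge0 ?normF_ge0 //.
  by rewrite mulVf // expr1n.
have [wB wU] : w *m B = 0 /\ w *m U = 0.
  by move: wQ; rewrite mul_mx_row -[0]hsubmxK !linear0 => /eq_row_mx.
have BX : B^T *m x = 0.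
  by rewrite /x -scalemxAr -trmx_mul wB trmx0 scaler0.
have UX : U^T *m x = 0.
  by rewrite /x -scalemxAr -trmx_mul wU trmx0 scaler0.
have QQ : (row_mx x U)^T *m row_mx x U = 1%:M.
  rewrite tr_row_mx mul_col_row xx UU UX.
  by rewrite -[x^T *m U]trmxK trmx_mul trmxK UX trmx0 -scalar_mx_block.
have BQ : B^T *m row_mx x U = 0 by rewrite mul_mx_row BX BU row_mx0.
by exists (row_mx x U).
Qed.

(** Over the complex numbers the characteristic polynomial has a root [z]. For an eigenvector [v]
    with conjugate [w], computing [v *m N *m w^T] in two ways shows that [z] equals its
    conjugate. *)
Lemma sym_eigenvalue (n : nat) (M : 'M[R]_n.+1) :
  M^T = M -> exists a, eigenvalue M a.
Proof.
move=> Msym; pose N := map_mx (real_complex R) M.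
have /closed_rootP[z] : size (char_poly N) != 1 by rewrite size_char_poly.
rewrite -eigenvalue_root_char => zN; have := zN.
case/eigenvalueP => v vN v0.
pose w := map_mx Num.conj v.
have wN : w *m N = Num.conj z *: w.
  rewrite -map_mxZ -vN map_mxM; congr (_ *m _).
  by apply/matrixP => i j; rewrite !mxE; apply/esym/CrealP/complex_realP; exists (M i j).
have vw : (v *m w^T) 0 0 != 0.
  have -> : (v *m w^T) 0 0 = \sum_i `|v 0 i| ^+ 2.
    by rewrite mxE; apply: eq_bigr => i _; rewrite !mxE normCK.
  rewrite psumr_neq0; last by move=> i _; rewrite exprn_ge0.
  have /rV0Pn[i vi] := v0.
  by apply/hasP; exists i; rewrite ?mem_index_enum //= exprn_gt0 // normr_gt0.
have zconj : z = Num.conj z.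
  have NT : N^T = N by rewrite /N map_trmx Msym.
  have : z * (v *m w^T) 0 0 = Num.conj z * (v *m w^T) 0 0.
    have -> : z * (v *m w^T) 0 0 = (v *m N *m w^T) 0 0.
      by rewrite vN -scalemxAl [RHS]mxE.
    have -> : v *m N *m w^T = Num.conj z *: (v *m w^T).
      by rewrite -mulmxA -{1}NT -trmx_mul wN [(_ *: w)^T]linearZ /= -scalemxAr.
    by rewrite [LHS]mxE.
  by move/(mulIf vw).
have /complex_realP[k zk] : z \is Num.real by rewrite CrealE -zconj.
exists k; move: zN; rewrite !eigenvalue_root_char /N -map_char_poly zk.
by rewrite fmorph_root.
Qed.

Lemma orthonormal_row_mx (n r k : nat) (V : 'M[R]_(n, r)) (U : 'M[R]_(n, k)) :
  V^T *m V = 1%:M -> U^T *m U = 1%:M -> V^T *m U = 0 ->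
  (row_mx V U)^T *m row_mx V U = 1%:M.
Proof.
move=> VV UU VU; rewrite tr_row_mx mul_col_row VV UU VU.
by rewrite -[U^T *m V]trmxK trmx_mul trmxK VU trmx0 -scalar_mx_block.
Qed.

(** A symmetric matrix that preserves a subspace preserves its orthogonal complement, so both
    off-diagonal blocks vanish. *)
Lemma invariant_block_diag (r k : nat) (M : 'M[R]_(r + k))
    (V : 'M[R]_(r + k, r)) (U : 'M[R]_(r + k, k)) :
  M^T = M -> V^T *m V = 1%:M -> U^T *m U = 1%:M -> V^T *m U = 0 ->
  M *m V = V *m (V^T *m M *m V) ->
  M = row_mx V U *m block_mx (V^T *m M *m V) 0 0 (U^T *m M *m U)
      *m (row_mx V U)^T.
Proof.
move=> Msym VV UU VU MV.
have /mulmx1C QQ := orthonormal_row_mx VV UU VU.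
have UMV : U^T *m M *m V = 0.
  by rewrite -mulmxA MV mulmxA -[U^T *m V]trmxK trmx_mul trmxK VU trmx0 mul0mx.
have VMU : V^T *m M *m U = 0.
  by apply: trmx_inj; rewrite !trmx_mul trmxK Msym mulmxA UMV trmx0.
have <- : (row_mx V U)^T *m M *m row_mx V U
    = block_mx (V^T *m M *m V) 0 0 (U^T *m M *m U).
  by rewrite tr_row_mx mul_col_mx mul_col_row VMU UMV.
by rewrite !mulmxA QQ mul1mx -mulmxA QQ mulmx1.
Qed.

Lemma char_poly_orthogonal_conj (n p : nat) (M : 'M[R]_n) (N : 'M[R]_p) (Q : 'M[R]_(n, p)) :
  n = p -> Q^T *m Q = 1%:M -> M = Q *m N *m Q^T -> char_poly M = char_poly N.
Proof.
move=> np; case: p / np N Q => N Q QQ ->.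
rewrite /char_poly /char_poly_mx !map_mxM.
have QQ' : map_mx polyC Q *m map_mx polyC Q^T = 1%:M.
  by rewrite -map_mxM (mulmx1C QQ) map_mx1.
have XE : 'X%:M = map_mx polyC Q *m 'X%:M *m map_mx polyC Q^T.
  by rewrite mul_mx_scalar -scalemxAl QQ' scalemx1.
by rewrite {1}XE -mulmxBl -mulmxBr !det_mulmx mulrAC -det_mulmx QQ' det1 mul1r.
Qed.

(** Deflation: split off a unit eigenvector and apply the induction hypothesis to the compression to
    its orthogonal complement. *)
Lemma spectral_theorem (n : nat) (M : 'M[R]_n) : M^T = M ->
  exists (Q : 'M[R]_n) (d : 'rV[R]_n),
    Q^T *m Q = 1%:M /\ M = Q *m diag_mx d *m Q^T.
Proof.
elim: n M => [|n IHn] M Msym.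
  by exists 1%:M, 0; split; rewrite [LHS]flatmx0 [RHS]flatmx0.
have [a /eigenvalueP[w wM w0]] := sym_eigenvalue Msym.
have nw0 : normF w != 0 by rewrite gt_eqF ?normF_gt0.
have [v vv Mav] : exists2 v : 'cV[R]_n.+1, v^T *m v = 1%:M & M *m v = a *: v.
  exists ((normF w)^-1 *: w^T).
    rewrite [LHS]mx11_scalar; congr (_%:M).
    rewrite -trace_mx11 -normF_sqr normFZ normF_tr ger0_norm ?invr_ge0 ?normF_ge0 //.
    by rewrite mulVf // expr1n.
  by rewrite -scalemxAr -{1}Msym -trmx_mul wM trmxZ !scalerA mulrC.
have Mv : M *m v = v *m (v^T *m M *m v).
  by rewrite -[v^T *m M *m v]mulmxA Mav -!scalemxAr vv mulmx1.
have [|U [UU vU]] := @orthonormal_extension n.+1 1 n v.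
  by have := rank_leq_col v; lia.
have [] := IHn (U^T *m M *m U); first by rewrite !trmx_mul trmxK Msym mulmxA.
move=> Q1 [d1 [QQ1 E1]].
have E := invariant_block_diag (r := 1) Msym vv UU vU Mv.
have QQ := orthonormal_row_mx vv UU vU.
set P := row_mx v U in E QQ.
have BB : (block_mx 1%:M 0 0 Q1)^T *m block_mx 1%:M 0 0 Q1 = 1%:M :> 'M[R]_(1 + n).
  rewrite tr_block_mx mulmx_block !trmx0 !mul0mx !mulmx0 !addr0 add0r QQ1.
  by rewrite trmx1 mulmx1 -scalar_mx_block.
have BD : block_mx (v^T *m M *m v) 0 0 (U^T *m M *m U) =
    block_mx 1%:M 0 0 Q1 *m diag_mx (row_mx (v^T *m M *m v) d1)
      *m (block_mx 1%:M 0 0 Q1)^T.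
  rewrite {1}E1 diag_mx_row tr_block_mx !mulmx_block !trmx0 !trmx1.
  rewrite !mul0mx !mulmx0 !addr0 !add0r !mul0mx !mulmx1 !mul1mx.
  congr (block_mx _ _ _ _); rewrite [LHS]mx11_scalar.
  by apply/matrixP => i j; rewrite !mxE !ord1.
exists (P *m block_mx 1%:M 0 0 Q1), (row_mx (v^T *m M *m v) d1); split.
  by rewrite trmx_mul mulmxA -[_ *m _ *m P]mulmxA QQ mulmx1.
by rewrite {1}E BD trmx_mul !mulmxA.
Qed.


(** The characteristic polynomial fixes the roots up to permutation, and sorting fixes their
    order. *)
Lemma spectrumE (n : nat) (M : 'M[R]_n) (s : seq R) :
  is_spectrum M s -> spectrum M = s.
Proof.
move=> hs; have [s1 e1] : is_spectrum M (spectrum M).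
  exact: (xgetPex [::] (ex_intro _ s hs)).
case: hs => s2 e2; apply: (sorted_eq ge_trans ge_anti) => //.
by apply: prod_XsubC_eq; rewrite -e1 -e2.
Qed.

Lemma char_poly_spectral (n : nat) (Q : 'M[R]_n) (d : 'rV[R]_n) :
  Q^T *m Q = 1%:M ->
  char_poly (Q *m diag_mx d *m Q^T) = \prod_(x <- [seq d 0 i | i <- enum 'I_n]) ('X - x%:P).
Proof.
move=> QQ; rewrite (char_poly_orthogonal_conj _ QQ (erefl _)) //.
rewrite char_poly_trig; last by apply: diag_mx_is_trig.
by rewrite big_map big_enum /=; apply: eq_bigr => i _; rewrite mxE eqxx.
Qed.

Lemma diag_conjE (n : nat) (Q : 'M[R]_n) (d : 'rV[R]_n) i j :
  (Q *m diag_mx d *m Q^T) i j = \sum_k Q i k * d 0 k * Q j k.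
Proof.
rewrite mxE; apply: eq_bigr => k _; rewrite [Q^T _ _]mxE; congr (_ * _).
by rewrite mul_mx_diag mxE.
Qed.

(** The columns of [Q] are permuted so that the diagonal is sorted and can be identified with
    [spectrum M]. *)
Lemma spectral_decomposition (n : nat) (M : 'M[R]_n) : M^T = M ->
  exists (Q : 'M[R]_n) (d : 'rV[R]_n),
    [/\ Q^T *m Q = 1%:M, M = Q *m diag_mx d *m Q^T,
        is_spectrum M [seq d 0 i | i <- enum 'I_n] & spectrum M = [seq d 0 i | i <- enum 'I_n]].
Proof.
move=> Msym; have [Q [d [QQ E]]] := spectral_theorem Msym.
pose t := [tuple d 0 i | i < n].
have /tuple_permP[p tp] : perm_eq (sort >=%R t) t by rewrite perm_sort.
have td i : tnth t i = d 0 i by rewrite tnth_mktuple.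
pose Q1 := \matrix_(i, j) Q i (p j); pose d1 := \row_i d 0 (p i).
have QQ1 : Q1^T *m Q1 = 1%:M.
  apply/matrixP => i j; have /matrixP/(_ (p i) (p j)) := QQ.
  rewrite !mxE (inj_eq perm_inj) => <-.
  by apply: eq_bigr => k _; rewrite !mxE.
have E1 : M = Q1 *m diag_mx d1 *m Q1^T.
  apply/matrixP => i j; rewrite {1}E !diag_conjE (reindex_inj (@perm_inj _ p)).
  by apply: eq_bigr => k _; rewrite !mxE.
have spec : is_spectrum M [seq d1 0 i | i <- enum 'I_n].
  split; last by rewrite E1 char_poly_spectral.
  have -> : [seq d1 0 i | i <- enum 'I_n] = sort >=%R t.
    by rewrite tp /=; apply: eq_map => i; rewrite mxE td.
  by apply: sort_sorted; apply: ge_total.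
by exists Q1, d1; split=> //; apply: spectrumE.
Qed.

Lemma spectrum_is_spectrum (n : nat) (M : 'M[R]_n) : M^T = M ->
  is_spectrum M (spectrum M).
Proof. by case/spectral_decomposition=> [Q [d [_ _ h ->]]]. Qed.

Lemma size_spectrum (n : nat) (M : 'M[R]_n) : M^T = M -> size (spectrum M) = n.
Proof.
by case/spectral_decomposition => [Q [d [_ _ _ ->]]]; rewrite size_map size_enum_ord.
Qed.

Lemma dot_diag (n : nat) (Q : 'M[R]_n) (d : 'rV[R]_n) (x : 'cV[R]_n) :
  dot x (Q *m diag_mx d *m Q^T *m x) = \sum_i d 0 i * (Q^T *m x) i 0 ^+ 2.
Proof.
have -> : dot x (Q *m diag_mx d *m Q^T *m x) =
    ((Q^T *m x)^T *m diag_mx d *m (Q^T *m x)) 0 0.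
  by rewrite /dot trmx_mul trmxK !mulmxA.
rewrite mxE; apply: eq_bigr => i _.
by rewrite mul_mx_diag mxE [(Q^T *m x)^T _ _]mxE; ring.
Qed.

Lemma dot_orthogonal (n : nat) (Q : 'M[R]_n) (x : 'cV[R]_n) :
  Q^T *m Q = 1%:M -> dot x x = \sum_i (Q^T *m x) i 0 ^+ 2.
Proof.
move=> /mulmx1C QQ; have -> : dot x x = ((Q^T *m x)^T *m (Q^T *m x)) 0 0.
  by rewrite /dot trmx_mul trmxK mulmxA -[_ *m Q *m _]mulmxA QQ mulmx1.
by rewrite mxE; apply: eq_bigr => i _; rewrite [(Q^T *m x)^T _ _]mxE.
Qed.

Lemma dot_normF (n : nat) (x : 'cV[R]_n) : dot x x = normF x ^+ 2.
Proof. by rewrite dot_tr normF_sqr. Qed.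

(** A dimension count gives a nonzero [x] orthogonal to the first [k] eigenvectors of [M] and to the
    last [n - k - 1] eigenvectors of [N]. The two quadratic forms at [x] are then compared. *)
Lemma lambda_weyl (n k : nat) (M N : 'M[R]_n) : (k < n)%N ->
  M^T = M -> N^T = N -> lambda k.+1 N - normF (M - N) <= lambda k.+1 M.
Proof.
move=> kn Ms Ns.
have [Q [d [QQ EM [dsort _] specM]]] := spectral_decomposition Ms.
have [P [e [PP EN [esort _] specN]]] := spectral_decomposition Ns.
pose K := Ordinal kn.
have nthE (f : 'rV[R]_n) (i : 'I_n) : nth 0 [seq f 0 j | j <- enum 'I_n] i = f 0 i.
  by rewrite (nth_map K) ?size_enum_ord // nth_ord_enum.
rewrite /lambda specM specN /= !(nthE _ K).
have mono (f : 'rV[R]_n) (i j : 'I_n) : sorted >=%R [seq f 0 i | i <- enum 'I_n] ->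
    (i <= j)%N -> f 0 j <= f 0 i.
  move=> fs ij; have := sorted_leq_nth ge_trans (@lexx _ _) 0 fs.
  have sz : size [seq f 0 i | i <- enum 'I_n] = n by rewrite size_map size_enum_ord.
  move=> /(_ i j); rewrite !inE !sz => /(_ (ltn_ord _) (ltn_ord _) ij).
  by rewrite !nthE.
(* The [n - 1] orthogonality conditions are padded with a zero row at index [k], so that [B] is
   square and singular. *)
pose B := \matrix_i (if (i < k)%N then row i Q^T else
                     if (k < i)%N then row i P^T else 0).
have BK : row K B = 0.
  by apply/rowP => j; rewrite !mxE ltnn /= mxE.
have /det0P[w w0 wB] : \det B^T == 0.
  rewrite det_tr; apply/det0P; exists (delta_mx 0 K); last by rewrite -rowE.
  by apply/rV0Pn; exists K; rewrite mxE !eqxx oner_eq0.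
pose x := w^T; have x0 : 0 < normF x by rewrite normF_gt0 // trmx_eq0.
have BX i : (B *m x) i 0 = 0.
  by rewrite -[B]trmxK -trmx_mul wB trmx0 mxE.
have Qx (i : 'I_n) : (i < k)%N -> (Q^T *m x) i 0 = 0.
  move=> ik; rewrite -[RHS](BX i) !mxE; apply: eq_bigr => j _.
  by rewrite !mxE ik !mxE.
have Px (i : 'I_n) : (k < i)%N -> (P^T *m x) i 0 = 0.
  move=> ik; rewrite -[RHS](BX i) !mxE; apply: eq_bigr => j _.
  by rewrite !mxE ik ltnNge (ltnW ik) /= !mxE.
have dM : dot x (M *m x) <= d 0 K * normF x ^+ 2.
  rewrite EM dot_diag -dot_normF (dot_orthogonal _ QQ) mulr_sumr.
  apply: ler_sum => i _; case: (ltnP i k) => ik.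
    by rewrite Qx // expr0n !mulr0.
  by rewrite ler_wpM2r ?sqr_ge0 // mono.
have dN : e 0 K * normF x ^+ 2 <= dot x (N *m x).
  rewrite EN dot_diag -dot_normF (dot_orthogonal _ PP) mulr_sumr.
  apply: ler_sum => i _; case: (ltnP k i) => ik.
    by rewrite Px // expr0n !mulr0.
  by rewrite ler_wpM2r ?sqr_ge0 // mono.
have dNM : dot x (N *m x) - dot x (M *m x) <= normF (M - N) * normF x ^+ 2.
  have -> : dot x (N *m x) - dot x (M *m x) = \tr ((- x)^T *m ((M - N) *m x)).
    by rewrite !dot_tr -mxtraceB -mulmxBr -mulmxBl trmxN mulNmx -mulmxN -mulNmx opprB.
  apply: le_trans (trmulmx_le _ _) _; rewrite normFN expr2 mulrA [_ * normF x * _]mulrC.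
  by apply: ler_wpM2l; [exact: normF_ge0 | exact: normFM].
have x2 : 0 < normF x ^+ 2 by rewrite exprn_gt0.
rewrite -(ler_pM2r x2); nra.
Qed.
End Spectral.

(** * Positive semidefinite matrices and the operator norm *)

Section PositiveSemidefinite.
Set Implicit Arguments.
Unset Strict Implicit.
Variable R : realType.

Lemma psd_sym (n : nat) (M : 'M[R]_n) : psd M -> M^T = M.
Proof. by case=> /symmetricmxP. Qed.

Lemma psd_conj (n p : nat) (M : 'M[R]_n) (B : 'M[R]_(n, p)) :
  psd M -> psd (B^T *m M *m B).
Proof.
move=> pM; split.
  by apply/symmetricmxP; rewrite !trmx_mul trmxK (psd_sym pM) mulmxA.
by move=> x; have := pM.2 (B *m x); rewrite /dot trmx_mul !mulmxA.
Qed.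

Lemma psd_conj' (n p : nat) (M : 'M[R]_n) (B : 'M[R]_(p, n)) :
  psd M -> psd (B *m M *m B^T).
Proof. by move=> pM; have := psd_conj B^T pM; rewrite trmxK. Qed.

Lemma psdD (n : nat) (M N : 'M[R]_n) : psd M -> psd N -> psd (M + N).
Proof.
move=> pM pN; split; first by apply/symmetricmxP; rewrite trmxD !psd_sym.
move=> x; rewrite dot_tr mulmxDl mulmxDr mxtraceD -!dot_tr.
by rewrite addr_ge0 ?pM.2 ?pN.2.
Qed.

Lemma psdZ (n : nat) (a : R) (M : 'M[R]_n) : 0 <= a -> psd M -> psd (a *: M).
Proof.
move=> a0 pM; split; first by apply/symmetricmxP; rewrite trmxZ psd_sym.
move=> x; rewrite dot_tr -scalemxAl -scalemxAr mxtraceZ -dot_tr.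
by rewrite mulr_ge0 ?pM.2.
Qed.

Lemma psd_diag (n : nat) (d : 'rV[R]_n) : (forall i, 0 <= d 0 i) -> psd (diag_mx d).
Proof.
move=> d0; split; first by apply/symmetricmxP; rewrite tr_diag_mx.
move=> x; rewrite /dot mulmxA mxE sumr_ge0 // => i _.
by rewrite mul_mx_diag !mxE mulrAC -expr2 mulr_ge0 ?sqr_ge0.
Qed.

Lemma psd_gram (n p : nat) (L : 'M[R]_(n, p)) : psd (L *m L^T).
Proof.
split; first by apply/symmetricmxP; rewrite trmx_mul trmxK.
move=> x; have -> : dot x (L *m L^T *m x) = dot (L^T *m x) (L^T *m x).
  by rewrite /dot trmx_mul trmxK !mulmxA.
by rewrite dot_normF sqr_ge0.
Qed.

Lemma psd_spectral (n : nat) (M : 'M[R]_n) : psd M ->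
  exists (Q : 'M[R]_n) (d : 'rV[R]_n),
    [/\ Q^T *m Q = 1%:M, M = Q *m diag_mx d *m Q^T & forall i, 0 <= d 0 i].
Proof.
move=> pM; have [Q [d [QQ E _ _]]] := spectral_decomposition (psd_sym pM).
(* The form of [Q^T *m M *m Q] at the [i]-th basis vector is [d 0 i]. *)
exists Q, d; split=> // i; have [_ /(_ (delta_mx i 0))] := psd_conj Q pM.
rewrite E !mulmxA QQ mul1mx -[_ *m Q^T *m Q]mulmxA QQ mulmx1 /dot mul_diag_mx trmx_delta -rowE !mxE.
by rewrite !eqxx mulr1.
Qed.

Lemma psd_factor (n : nat) (M : 'M[R]_n) : psd M -> exists L : 'M[R]_n, M = L *m L^T.
Proof.
move=> /psd_spectral[Q [d [QQ E d0]]].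
exists (Q *m diag_mx (\row_i Num.sqrt (d 0 i))).
rewrite trmx_mul tr_diag_mx mulmxA -[Q *m _ *m diag_mx _]mulmxA mulmx_diag E.
congr (_ *m diag_mx _ *m _); apply/rowP => i.
by rewrite !mxE -expr2 sqr_sqrtr.
Qed.

Lemma psd_mxtrace_ge0 (n : nat) (M : 'M[R]_n) : psd M -> 0 <= \tr M.
Proof. by move/psd_factor=> [L ->]; rewrite -{1}[L]trmxK -normF_sqr sqr_ge0. Qed.

Lemma trmul_psd_ge0 (n : nat) (M N : 'M[R]_n) : psd M -> psd N -> 0 <= \tr (M *m N).
Proof.
move=> pM /psd_factor[L ->]; rewrite mulmxA mxtrace_mulC mulmxA.
exact: psd_mxtrace_ge0 (psd_conj L pM).
Qed.

(** For [M = K K^T] and [N = L L^T] the trace is the squared norm of [K^T *m L]. *)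
Lemma trmul_psd_eq0 (n : nat) (M N : 'M[R]_n) :
  psd M -> psd N -> \tr (M *m N) = 0 -> M *m N = 0.
Proof.
move=> /psd_factor[K ->] /psd_factor[L ->].
rewrite mulmxA mxtrace_mulC.
have -> : L^T *m (K *m K^T *m L) = (K^T *m L)^T *m (K^T *m L).
  by rewrite trmx_mul trmxK !mulmxA.
rewrite -normF_sqr => /eqP; rewrite sqrf_eq0 => /eqP/normF_eq0 KL.
by rewrite -[K *m _ *m L]mulmxA KL mulmx0 mul0mx.
Qed.

(** With [M = L L^T], both sides are compared with the squared norm of [L]. *)
Lemma normF_psd_le (n : nat) (M : 'M[R]_n) : psd M -> normF M <= \tr M.
Proof.
move/psd_factor=> [L ->]; apply: le_trans (normFM _ _) _.
by rewrite normF_tr -expr2 normF_sqr mxtrace_mulC.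
Qed.

Lemma psd_spectral_ge (n : nat) (M Q : 'M[R]_n) (d : 'rV[R]_n) (a : R) :
  Q^T *m Q = 1%:M -> M = Q *m diag_mx d *m Q^T -> (forall i, a <= d 0 i) ->
  psd (M - a%:M).
Proof.
move=> /mulmx1C QQ -> ad.
have -> : a%:M = Q *m diag_mx (const_mx a) *m Q^T.
  by rewrite diag_const_mx mul_mx_scalar -scalemxAl QQ scalemx1.
rewrite -mulmxBl -mulmxBr -linearB; apply: psd_conj'; apply: psd_diag => i.
by rewrite !mxE subr_ge0.
Qed.

Lemma normF_mul_le_normop (p q : nat) (M : 'M[R]_(p, q)) (x : 'cV[R]_q) :
  normF x <= 1 -> normF (M *m x) <= normop M.
Proof.
move=> x1; apply: sup_upper_bound; last by exists x.
split; first by exists (normF (M *m x)); exists x.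
exists (normF M) => _ [y /= y1 <-].
by apply: le_trans (normFM _ _) _; rewrite ler_piMr ?normF_ge0.
Qed.

Lemma normop_ge0 (p q : nat) (M : 'M[R]_(p, q)) : 0 <= normop M.
Proof.
by have := @normF_mul_le_normop p q M 0; rewrite mulmx0 !normF0; apply.
Qed.

Lemma normop_le_normF (p q : nat) (M : 'M[R]_(p, q)) : normop M <= normF M.
Proof.
apply: ge_sup; first by exists (normF (M *m (0 : 'cV[R]_q))), 0; rewrite //= normF0.
move=> _ [y /= y1 <-].
by apply: le_trans (normFM _ _) _; rewrite ler_piMr ?normF_ge0.
Qed.

(** The eigenvalues of [M] lie between 0 and [normop M], so [normop M *: M - M *m M] is positive
    semidefinite. Conjugate by [B] and take the trace. *)
Lemma normF_psd_mul_sqr_le (n p : nat) (M : 'M[R]_n) (B : 'M[R]_(n, p)) : psd M ->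
  normF (M *m B) ^+ 2 <= normop M * \tr (B^T *m M *m B).
Proof.
move=> pM; have [Q [d [QQ E d0]]] := psd_spectral pM.
have dle i : d 0 i <= normop M.
  have nQ : normF (col i Q) = 1.
    apply/eqP; rewrite -(@eqrXn2 _ 2) ?normF_ge0 // expr1n -dot_normF.
    have /matrixP/(_ i i) := QQ; rewrite !mxE eqxx mulr1n => <-.
    by apply/eqP; rewrite /dot mxE; apply: eq_bigr => j _; rewrite !mxE.
  have -> : d 0 i = normF (M *m col i Q).
    have -> : M *m col i Q = d 0 i *: col i Q.
      have MQ : M *m Q = Q *m diag_mx d by rewrite E -mulmxA QQ mulmx1.
      apply/colP => k; have /matrixP/(_ k i) := MQ; rewrite mul_mx_diag !mxE mulrC => <-.
      by apply: eq_bigr => j _; rewrite !mxE.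
    by rewrite normFZ nQ mulr1 ger0_norm.
  by rewrite normF_mul_le_normop // nQ.
have psdB : psd (normop M *: M - M *m M).
  have -> : normop M *: M = Q *m diag_mx (normop M *: d) *m Q^T.
    by rewrite {2}E linearZ /= -scalemxAr -scalemxAl.
  have -> : M *m M = Q *m diag_mx (\row_i (d 0 i * d 0 i)) *m Q^T.
    rewrite {1 2}E !mulmxA -[_ *m Q^T *m Q]mulmxA QQ mulmx1.
    by rewrite -[Q *m _ *m diag_mx _]mulmxA mulmx_diag.
  rewrite -mulmxBl -mulmxBr -linearB.
  apply: psd_conj'; apply: psd_diag => i; rewrite !mxE -mulrBl mulr_ge0 // subr_ge0.
  exact: dle.
have := psd_mxtrace_ge0 (psd_conj B psdB).
rewrite mulmxBr mulmxBl mxtraceB -scalemxAr -scalemxAl mxtraceZ subr_ge0.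
by rewrite normF_sqr trmx_mul (psd_sym pM) !mulmxA.
Qed.

End PositiveSemidefinite.

(** * Invariant subspaces and smallest eigenvalues *)

Section Eigenbases.
Set Implicit Arguments.
Unset Strict Implicit.
Variable R : realType.

Lemma invariant_block_sum (r k : nat) (M : 'M[R]_(r + k))
    (V : 'M[R]_(r + k, r)) (U : 'M[R]_(r + k, k)) :
  M^T = M -> V^T *m V = 1%:M -> U^T *m U = 1%:M -> V^T *m U = 0 ->
  M *m V = V *m (V^T *m M *m V) ->
  M = V *m (V^T *m M *m V) *m V^T + U *m (U^T *m M *m U) *m U^T.
Proof.
move=> Ms VV UU VU MV; rewrite {1}(invariant_block_diag Ms VV UU VU MV).
by rewrite mul_row_block !mulmx0 addr0 add0r tr_row_mx mul_row_col.
Qed.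

Lemma complement_projector (r k : nat) (V : 'M[R]_(r + k, r)) (U : 'M[R]_(r + k, k)) :
  V^T *m V = 1%:M -> U^T *m U = 1%:M -> V^T *m U = 0 ->
  1%:M - V *m V^T = U *m U^T.
Proof.
move=> VV UU VU; have := mulmx1C (orthonormal_row_mx VV UU VU).
by rewrite tr_row_mx mul_row_col => <-; rewrite addrAC subrr add0r.
Qed.

Lemma char_poly_invariant (r k : nat) (M : 'M[R]_(r + k))
    (V : 'M[R]_(r + k, r)) (U : 'M[R]_(r + k, k)) :
  M^T = M -> V^T *m V = 1%:M -> U^T *m U = 1%:M -> V^T *m U = 0 ->
  M *m V = V *m (V^T *m M *m V) ->
  char_poly M = char_poly (V^T *m M *m V) * char_poly (U^T *m M *m U).
Proof.
move=> Ms VV UU VU MV.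
rewrite (char_poly_orthogonal_conj (erefl _) (orthonormal_row_mx VV UU VU)
  (invariant_block_diag Ms VV UU VU MV)).
by rewrite /char_poly char_block_diag_mx det_ublock.
Qed.

Lemma orthonormal_complement (r k : nat) (V : 'M[R]_(r + k, r)) :
  exists U : 'M[R]_(r + k, k), U^T *m U = 1%:M /\ V^T *m U = 0.
Proof. by apply: orthonormal_extension; rewrite leq_add2r rank_leq_col. Qed.

(** On the range of [V] only [psd M] is used. On the complement the eigenvalues are the [n - r]
    largest ones of [M], the least of which is [lambda (n - r) M]. *)
Lemma smallest_eigenbasis_psd (n r : nat) (M : 'M[R]_n) (V : 'M[R]_(n, r)) :
  (r < n)%N -> psd M -> smallest_eigenbasis M V ->
  psd (M - lambda (n - r) M *: (1%:M - V *m V^T)).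
Proof.
(* The dimension is replaced by [r + k], the type that block matrices require. *)
move=> rn; have En : n = (r + (n - r))%N by rewrite subnKC // ltnW.
move: rn; rewrite -subn_gt0; move: (n - r)%N En => k En k0.
subst n => pM [VV MV]; rewrite addKn => specV.
have Ms := psd_sym pM.
have [U [UU VU]] := orthonormal_complement V.
set t := lambda k M.
pose W := U^T *m M *m U.
have pW : psd W by apply: psd_conj.
have [Q [d [QQ EW [_ cW] _]]] := spectral_decomposition (psd_sym pW).
have [sM cM] := spectrum_is_spectrum Ms.
have [_ cV] := spectrum_is_spectrum (psd_sym (psd_conj V pM)).
have dt i : t <= d 0 i.
  (* Cancelling the factor of the block of [V] in the characteristic polynomial of [M] leaves the
     first [k] roots. *)
  have : perm_eq [seq d 0 i | i <- enum 'I_k] (take k (spectrum M)).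
    apply: prod_XsubC_eq; rewrite -cW.
    have := char_poly_invariant Ms VV UU VU MV.
    rewrite cM cV specV -{1}[spectrum M](cat_take_drop k) big_cat /= mulrC.
    by move/esym/mulfI; apply; apply/monic_neq0/monic_prod_XsubC.
  move/perm_mem/(_ (d 0 i)); rewrite map_f ?mem_enum // => /esym/(nthP 0)[j].
  rewrite size_take size_spectrum // => jk <-.
  have {}jk : (j < k)%N by move: jk; case: ifP => //; lia.
  rewrite nth_take // /t /lambda.
  have := sorted_leq_nth ge_trans (@lexx _ _) 0 sM.
  move=> /(_ j k.-1); rewrite !inE !size_spectrum //; apply; lia.
have pWt : psd (W - t%:M) by apply: psd_spectral_ge EW dt.
have -> : M - t *: (1%:M - V *m V^T) =
    V *m (V^T *m M *m V) *m V^T + U *m (W - t%:M) *m U^T.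
  rewrite (complement_projector VV UU VU) mulmxBr mulmxBl addrA mul_mx_scalar -scalemxAl.
  by congr (_ - _); apply: invariant_block_sum.
by apply: psdD; apply: psd_conj'; rewrite // ; apply: psd_conj.
Qed.

Lemma psd_unit_spectral (n : nat) (M : 'M[R]_n) : psd M -> M \in unitmx ->
  exists (Q : 'M[R]_n) (d : 'rV[R]_n),
    [/\ Q^T *m Q = 1%:M, M = Q *m diag_mx d *m Q^T & forall i, 0 < d 0 i].
Proof.
move=> pM uM; have [Q [d [QQ E d0]]] := psd_spectral pM.
exists Q, d; split=> // i; rewrite lt_neqAle d0 andbT eq_sym.
have : \det (diag_mx d) != 0.
  apply: contraL uM => /eqP d00; rewrite unitmxE E !det_mulmx d00.
  by rewrite mulr0 mul0r unitr0.
rewrite det_diag; apply: contraNneq => di; apply/eqP.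
by rewrite (bigD1 i) //= di mul0r.
Qed.

Lemma psd_unit_ge (n : nat) (M : 'M[R]_n) : psd M -> M \in unitmx ->
  exists2 a : R, 0 < a & psd (M - a%:M).
Proof.
move=> pM uM; have [Q [d [QQ E d0]]] := psd_unit_spectral pM uM.
have [a a0 ad] : exists2 a : R, 0 < a & forall i, a <= d 0 i.
  (* The default 1 keeps the minimum positive even for [n = 0]. *)
  exists (\big[Num.min/1]_i d 0 i).
    by apply: (big_ind (fun x => 0 < x)) => // x y x0 y0; rewrite lt_min x0.
  by move=> i; rewrite (bigD1 i) //= ge_min lexx.
by exists a => //; apply: psd_spectral_ge E ad.
Qed.

Lemma is_spectrum0 (n : nat) : is_spectrum (0 : 'M[R]_n) (nseq n 0).
Proof.
split; first by elim: n => //= -[|n] //= ->; rewrite lexx.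
rewrite char_poly_trig; last by apply/is_trig_mxP => i j _; rewrite mxE.
rewrite (eq_bigr (fun=> 'X - 0%:P)); last by move=> i _; rewrite mxE.
by rewrite big_const_ord big_nseq_cond /=; elim: n => //= n ->.
Qed.

(** The spectrum of [M] is that of its compression [W] to the complement of the kernel, which is
    positive, followed by [r] zeros. *)
Lemma kernel_smallest_eigenbasis (n r : nat) (M : 'M[R]_n) (V : 'M[R]_(n, r)) :
  (r < n)%N -> psd M -> orthonormal_cols V -> M *m V = 0 -> (r + \rank M)%N = n ->
  smallest_eigenbasis M V /\ 0 < lambda (n - r) M.
Proof.
move=> rn pM VV MV rkM; have En : n = (r + (n - r))%N by rewrite subnKC // ltnW.
have {}rkM : \rank M = (n - r)%N by rewrite -[in RHS]rkM addKn.
move: rn; rewrite -subn_gt0; move: (n - r)%N En rkM => k En rkM k0.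
subst n.
have Ms := psd_sym pM.
have [U [UU VU]] := orthonormal_complement V.
pose W := U^T *m M *m U.
have VMV : V^T *m M *m V = 0 by rewrite -mulmxA MV mulmx0.
have MV' : M *m V = V *m (V^T *m M *m V) by rewrite VMV mulmx0 MV.
have pW : psd W by apply: psd_conj.
(* [M] factors through the [k]-by-[k] matrix [W] and has rank [k]. *)
have uW : W \in unitmx.
  rewrite -row_full_unit -col_leq_rank -[X in (X <= _)%N]rkM.
  rewrite {1}(invariant_block_sum Ms VV UU VU MV') VMV mulmx0 mul0mx add0r.
  by rewrite (leq_trans (mxrankM_maxl _ _)) ?mxrankM_maxr.
have [a a0 pWa] := psd_unit_ge pW uW.
have [sW cW] := spectrum_is_spectrum (psd_sym pW).
have sz : size (spectrum W) = k by rewrite size_spectrum // psd_sym.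
have Wa x : x \in spectrum W -> a <= x.
  rewrite -root_prod_XsubC -cW -eigenvalue_root_char => /eigenvalueP[v vW v0].
  have := pWa.2 v^T; rewrite dot_tr mulmxBl mulmxBr mxtraceB trmxK.
  rewrite mulmxA vW -scalemxAl mxtraceZ mul_scalar_mx -scalemxAr mxtraceZ.
  have : 0 < \tr (v *m v^T).
    by rewrite -{1}[v]trmxK -normF_sqr exprn_gt0 // normF_gt0 // trmx_eq0.
  by move=> v0'; rewrite -mulrBl pmulr_lge0 // subr_ge0.
have specM : spectrum M = spectrum W ++ nseq r 0.
  apply: spectrumE; split.
    rewrite sorted_pairwise ?pairwise_cat -?sorted_pairwise; try exact: ge_trans.
    rewrite sW (is_spectrum0 r).1 !andbT; apply/allrelP => x y xW.
    by rewrite mem_nseq => /andP[_ /eqP->]; apply: le_trans (ltW a0) (Wa _ xW).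
  rewrite (char_poly_invariant Ms VV UU VU MV') big_cat /= -cW VMV.
  by rewrite (is_spectrum0 r).2 mulrC.
split; last first.
  rewrite /lambda specM nth_cat sz ltn_predL k0.
  by apply: lt_le_trans a0 (Wa _ _); rewrite mem_nth // sz ltn_predL.
split=> //; rewrite VMV specM addKn drop_size_cat //.
exact: spectrumE (is_spectrum0 r).
Qed.

End Eigenbases.

(** * Quantitative injectivity, orthogonal projectors, and the boundary of the semidefinite cone *)

Section Projections.
Set Implicit Arguments.
Unset Strict Implicit.
Variable R : realType.

Lemma normF_mxvec (p q : nat) (H : 'M[R]_(p, q)) : normF (mxvec H) = normF H.
Proof.
rewrite /normF big_ord1 pair_big /=; congr Num.sqrt.
rewrite (reindex _ (curry_mxvec_bij p q)) /=.
by apply: eq_bigr => -[i j] _ /=; rewrite mxvecE.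
Qed.

(* If ker f is contained in ker h then h factors linearly through f. *)
Lemma linear_kernel_bound (p q p1 q1 p2 q2 : nat)
    (f : 'M[R]_(p, q) -> 'M[R]_(p1, q1)) (h : 'M[R]_(p, q) -> 'M[R]_(p2, q2)) :
  linear f -> linear h -> (forall x, f x = 0 -> h x = 0) ->
  exists2 K : R, 0 < K & forall x, normF (h x) <= K * normF (f x).
Proof.
move=> lf lh fh.
pose mf := GRing.isLinear.Build _ _ _ _ f lf.
pose mh := GRing.isLinear.Build _ _ _ _ h lh.
pose f' : {linear _ -> _} := HB.pack f mf.
pose h' : {linear _ -> _} := HB.pack h mh.
pose F := lin_mx f'; pose H := lin_mx h'.
(* The rows of [1 - F *m pinvmx F] are killed by [F], hence by [H]. *)
have FH : H = F *m (pinvmx F *m H).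
  apply/eqP; rewrite -subr_eq0 mulmxA -{1}[H]mul1mx -mulmxBl; apply/eqP/row_matrixP => i.
  set N := 1%:M - _; rewrite row0 row_mul.
  have NF : row i N *m F = 0.
    by rewrite -row_mul mulmxBl mul1mx mulmxKpV ?submx_refl // subrr row0.
  have := fh (vec_mx (row i N)).
  rewrite -[f _]/(f' _) -[h _]/(h' _) => fh'.
  rewrite mul_rV_lin fh' ?linear0 //.
  by rewrite -[LHS]mxvecK -mul_rV_lin NF linear0.
move: (pinvmx F *m H) FH => D FH.
(* The added 1 makes the constant positive even if [D = 0]. *)
exists (normF D + 1) => [|x]; first by rewrite ltr_wpDl ?normF_ge0.
rewrite -normF_mxvec -[h x]/(h' x) -mul_vec_lin -/H FH mulmxA mul_vec_lin.
apply: le_trans (normFM _ _) _; rewrite normF_mxvec.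
by rewrite mulrDl mul1r mulrC lerDl normF_ge0.
Qed.

Definition projector (n : nat) (P : 'M[R]_n) : Prop := P^T = P /\ P *m P = P.

Lemma projector_cols (n r : nat) (V : 'M[R]_(n, r)) :
  orthonormal_cols V -> projector (V *m V^T).
Proof.
move=> VV; split; first by rewrite trmx_mul trmxK.
by rewrite mulmxA -[_ *m V^T *m V]mulmxA VV mulmx1.
Qed.

Lemma projectorC (n : nat) (P : 'M[R]_n) : projector P -> projector (1%:M - P).
Proof.
case=> Ps PP; split; first by rewrite trmxB trmx1 Ps.
by rewrite mulmxBr mulmx1 mulmxBl mul1mx PP subrr subr0.
Qed.

Lemma projector_mulC (n : nat) (P : 'M[R]_n) : projector P -> P *m (1%:M - P) = 0.
Proof. by case=> Ps PP; rewrite mulmxBr mulmx1 PP subrr. Qed.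

Lemma projector_sandwich (n : nat) (P Y : 'M[R]_n) :
  projector P -> P *m (P *m Y *m P) *m P = P *m Y *m P.
Proof. by case=> Ps PP; rewrite !mulmxA PP -mulmxA PP. Qed.

Lemma projector_psd (n : nat) (P : 'M[R]_n) : projector P -> psd P.
Proof. by case=> Ps PP; rewrite -PP -{2}Ps; apply: psd_gram. Qed.

(** Pythagoras for [P *m B] and [(1%:M - P) *m B]. *)
Lemma normF_projl (n p : nat) (P : 'M[R]_n) (B : 'M[R]_(n, p)) :
  projector P -> normF (P *m B) <= normF B.
Proof.
move=> pP; apply: normF_leP; first exact: normF_ge0.
have BE : B = P *m B + (1%:M - P) *m B by rewrite mulmxBl mul1mx addrC subrK.
rewrite {2}BE normF_sqrD trmx_mul pP.1 -mulmxA [P *m (_ *m _)]mulmxA.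
rewrite (projector_mulC pP) mul0mx mulmx0.
by rewrite mxtrace0 mulr0 addr0 lerDl sqr_ge0.
Qed.

(** With [N = 1 - P], the error is [N X N], of norm at most its trace, plus the off-diagonal blocks
    [P X N] and [N X P], each of squared norm at most [e * normop X]. *)
Lemma projection_error (n : nat) (P X : 'M[R]_n) (e : R) :
  projector P -> psd X -> \tr ((1%:M - P) *m X) <= e ->
  normF (X - P *m X *m P) <= e + Num.sqrt (2 * e * normop X).
Proof.
move=> pP pX; have pN := projectorC pP; have PN := projector_mulC pP.
set N := 1%:M - P in pN PN * => trN.
have NP : N *m P = 0 by rewrite -pN.1 -pP.1 -trmx_mul PN trmx0.
have PNE : 1%:M = P + N by rewrite addrC subrK.
clearbody N.
have XE : X = P *m X *m P + (N *m X *m N + (P *m X *m N + N *m X *m P)).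
  rewrite -{1}[X]mul1mx -{1}[1%:M *m X]mulmx1 PNE !mulmxDl !mulmxDr.
  by rewrite -addrA; congr (_ + _); rewrite addrA addrC.
rewrite {1}XE addrAC subrr add0r.
have trNXN : \tr (N *m X *m N) <= e.
  by rewrite mxtrace_mulC mulmxA pN.2.
have pNXN : psd (N *m X *m N) by have := psd_conj N pX; rewrite pN.1.
have e0 : 0 <= e by apply: le_trans trNXN; apply: psd_mxtrace_ge0.
apply: le_trans (normFD _ _) _; apply: lerD.
  exact: le_trans (normF_psd_le pNXN) trNXN.
have ne0 : 0 <= 2 * e * normop X by rewrite !mulr_ge0 ?normop_ge0.
apply: normF_leP; first exact: sqrtr_ge0.
rewrite [leRHS]sqr_sqrtr // normF_sqrD.
have -> : N *m X *m P = (P *m X *m N)^T.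
  by rewrite !trmx_mul pN.1 pP.1 (psd_sym pX) mulmxA.
(* The off-diagonal blocks are orthogonal because [N *m P = 0]; this is why the square root contains
   2. *)
rewrite normF_tr -trmx_mul mxtrace_tr.
rewrite -[P *m X *m N *m _]mulmxA [N *m (P *m X *m N)]mulmxA [N *m (P *m X)]mulmxA NP.
rewrite !mul0mx mulmx0 mxtrace0 mulr0 addr0.
have : normF (P *m X *m N) ^+ 2 <= e * normop X.
  have := normF_psd_mul_sqr_le N pX; rewrite pN.1 => h.
  apply: le_trans (_ : normF (X *m N) ^+ 2 <= _).
    by rewrite ler_sqr ?nnegrE ?normF_ge0 // -mulmxA normF_projl.
  by apply: le_trans h _; rewrite mulrC ler_wpM2r // normop_ge0.
by lra.
Qed.

Lemma psd_scalar_sub (n : nat) (H : 'M[R]_n) (a : R) :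
  H^T = H -> normF H <= a -> psd (a%:M - H).
Proof.
move=> Hs Ha; split; first by apply/symmetricmxP; rewrite trmxB tr_scalar_mx Hs.
move=> x; rewrite dot_tr mulmxBl mulmxBr mxtraceB mul_scalar_mx -scalemxAr mxtraceZ.
rewrite -normF_sqr subr_ge0; apply: le_trans (trmulmx_le _ _) _.
rewrite expr2 mulrCA; apply: ler_wpM2l; first exact: normF_ge0.
by apply: le_trans (normFM _ _) _; apply: ler_wpM2r; rewrite ?normF_ge0.
Qed.

(* With S = L L^T and G = L^-1 W L^-T, S + t W = L (1 + t G) L^T reaches the
   boundary of the cone at t = - 1 / w, w an eigenvalue of G of largest modulus. *)
Lemma psd_line_singular (r : nat) (S W : 'M[R]_r) :
  psd S -> S \in unitmx -> W^T = W -> W != 0 ->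
  exists2 t, psd (S + t *: W) & S + t *: W \notin unitmx.
Proof.
move=> pS uS Ws W0; have [L SL] := psd_factor pS.
have uL : L \in unitmx by move: uS; rewrite SL unitmx_mul => /andP[].
have uLT : L^T \in unitmx by rewrite unitmx_tr.
pose G := invmx L *m W *m invmx L^T.
have WG : W = L *m G *m L^T by rewrite /G !mulmxA mulmxV // mul1mx mulmxKV.
have Gs : G^T = G by rewrite /G !trmx_mul !trmx_inv trmxK Ws mulmxA.
have [Q [w [QQ EG _ _]]] := spectral_decomposition Gs.
have [i0 wi0] : exists i0, w 0 i0 != 0.
  apply/rV0Pn; apply: contraNneq W0 => w0.
  by rewrite WG EG w0 linear0 mulmx0 mul0mx mulmx0 mul0mx.
pose i := [arg max_(i > i0) `|w 0 i|]%O.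
have imax j : `|w 0 j| <= `|w 0 i|.
  by rewrite /i; case: arg_maxP => // k _; apply.
have wi : 0 < `|w 0 i| by apply: lt_le_trans (imax i0); rewrite normr_gt0.
have E : S + (- (w 0 i)^-1) *: W
    = (L *m Q) *m diag_mx (\row_j (1 - w 0 j / w 0 i)) *m (L *m Q)^T.
  have -> : diag_mx (\row_j (1 - w 0 j / w 0 i)) = 1%:M + (- (w 0 i)^-1) *: diag_mx w.
    by apply/matrixP => a c; rewrite !mxE; case: eqVneq => _; rewrite ?mulr1n ?mulr0n; ring.
  rewrite trmx_mul mulmxDr mulmxDl mulmx1 -scalemxAr -scalemxAl; congr (_ + _ *: _).
    by rewrite mulmxA -[_ *m Q *m Q^T]mulmxA (mulmx1C QQ) mulmx1.
  by rewrite WG EG !mulmxA.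
exists (- (w 0 i)^-1); rewrite E.
  apply: psd_conj'; apply: psd_diag => j; rewrite mxE subr_ge0.
  apply: le_trans (ler_norm _) _; rewrite normrM normfV ler_pdivrMr // mul1r.
  exact: imax.
rewrite unitmxE !det_mulmx det_diag (bigD1 i) //= mxE divff ?subrr; last first.
  by rewrite -normr_gt0.
by rewrite mul0r mulr0 mul0r unitr0.
Qed.

End Projections.

(** * The operator of the program, its extremal singular values, and the compressed problem *)

Section SemidefiniteProgram.
Set Implicit Arguments.
Unset Strict Implicit.
Variables (R : realType) (n m : nat).
Variables (A : 'I_m -> 'M[R]_n) (b : 'cV[R]_m) (C : 'M[R]_n).

Lemma calA_linear : linear (calA A).
Proof.
by move=> a G H; apply/colP => i; rewrite !mxE mulmxDr mxtraceD -scalemxAr mxtraceZ.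
Qed.

Lemma calAD (G H : 'M[R]_n) : calA A (G + H) = calA A G + calA A H.
Proof. by have := calA_linear 1 G H; rewrite !scale1r. Qed.

Lemma calA0 : calA A 0 = 0.
Proof. by apply/colP => i; rewrite !mxE mulmx0 mxtrace0. Qed.

Lemma calAZ (a : R) (H : 'M[R]_n) : calA A (a *: H) = a *: calA A H.
Proof. by have := calA_linear a H 0; rewrite !addr0 calA0 addr0. Qed.

Lemma calAB (G H : 'M[R]_n) : calA A (G - H) = calA A G - calA A H.
Proof. by rewrite calAD -scaleN1r calAZ scaleN1r. Qed.

Lemma calAT_linear : linear (calAT A).
Proof.
move=> a y z; rewrite /calAT scaler_sumr -big_split /=.
by apply: eq_bigr => i _; rewrite !mxE scalerDl scalerA.
Qed.

Lemma calAT_scaleD (a : R) (y z : 'cV[R]_m) :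
  calAT A (y + a *: z) = calAT A y + a *: calAT A z.
Proof. by rewrite addrC calAT_linear addrC. Qed.

Lemma calAT_adjoint (y : 'cV[R]_m) (H : 'M[R]_n) :
  \tr (calAT A y *m H) = dot (calA A H) y.
Proof.
rewrite /calAT mulmx_suml raddf_sum /dot mxE; apply: eq_bigr => i _ /=.
by rewrite -scalemxAl mxtraceZ !mxE mulrC.
Qed.

Lemma calA_le (H : 'M[R]_n) : normF (calA A H) <= sigma_max A * normF H.
Proof.
have [->|H0] := eqVneq H 0; first by rewrite calA0 !normF0 mulr0.
have nH := normF_gt0 H0.
(* The supremum defining [sigma_max] has to be finite; the kernel bound with [f := id] shows it. *)
have [K K0 AK] : exists2 K, 0 < K & forall G, normF (calA A G) <= K * normF G.
  apply: (linear_kernel_bound (f := id) _ calA_linear) => [a G G' //|_ ->].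
  exact: calA0.
rewrite -ler_pdivrMr // -[_ / _]mulrC.
have -> : (normF H)^-1 * normF (calA A H) = normF (calA A ((normF H)^-1 *: H)).
  by rewrite calAZ normFZ ger0_norm // invr_ge0 ltW.
apply: sup_upper_bound; last first.
  by exists ((normF H)^-1 *: H) => //=; rewrite normFZ ger0_norm ?invr_ge0 1?ltW // mulVf ?gt_eqF.
split.
  exists (normF (calA A ((normF H)^-1 *: H))), ((normF H)^-1 *: H) => //=.
  by rewrite normFZ ger0_norm ?invr_ge0 1?ltW // mulVf ?gt_eqF.
by exists K => _ [G /= G1 <-]; rewrite -[K]mulr1 -G1.
Qed.

Lemma normF1_gt0 (p : nat) : (0 < p)%N -> 0 < normF (1%:M : 'M[R]_p).
Proof. by case: p => // p _; apply: normF_gt0; rewrite oner_neq0. Qed.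

Lemma sigma_max_ge0 : (0 < n)%N -> 0 <= sigma_max A.
Proof.
move=> n0; rewrite -(pmulr_lge0 _ (normF1_gt0 n0)).
by apply: le_trans (calA_le _); apply: normF_ge0.
Qed.

Lemma compress_linear (r : nat) (V : 'M[R]_(n, r)) : linear (compress A V).
Proof.
move=> a S S'; rewrite /compress mulmxDr mulmxDl calAD.
by rewrite -scalemxAr -scalemxAl calAZ.
Qed.

Lemma sigma_min_le (r : nat) (V : 'M[R]_(n, r)) (S : 'M[R]_r) : S^T = S ->
  sigma_min A V * normF S <= normF (compress A V S).
Proof.
move=> Ss; have [->|S0] := eqVneq S 0; first by rewrite normF0 mulr0 normF_ge0.
have nS := normF_gt0 S0.
rewrite -ler_pdivlMr // -[_ / _]mulrC.
have -> : (normF S)^-1 * normF (compress A V S) = normF (compress A V ((normF S)^-1 *: S)).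
  have := compress_linear V (normF S)^-1 S 0; rewrite !addr0 => ->.
  by rewrite /compress mulmx0 mul0mx calA0 addr0 normFZ ger0_norm // invr_ge0 ltW.
apply: inf_lbound; first by exists 0 => _ [S' _ <-]; apply: normF_ge0.
exists ((normF S)^-1 *: S) => //=; split; first by apply/symmetricmxP; rewrite trmxZ Ss.
by rewrite normFZ ger0_norm ?invr_ge0 1?ltW // mulVf ?gt_eqF.
Qed.

(** For [r > 0] the normalized identity makes the index set nonempty, so that a lower bound of the
    set is below its infimum. *)
Lemma sigma_min_ge (r : nat) (V : 'M[R]_(n, r)) (a : R) : (0 < r)%N ->
  (forall S, S^T = S -> a * normF S <= normF (compress A V S)) -> a <= sigma_min A V.
Proof.
move=> r0 aV; apply: lb_le_inf; last first.
  by move=> _ [S /= [/symmetricmxP Ss S1] <-]; rewrite -[a]mulr1 -S1 aV.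
have nn1 := normF1_gt0 r0.
exists (normF (compress A V ((normF (1%:M : 'M[R]_r))^-1 *: 1%:M))).
exists ((normF (1%:M : 'M[R]_r))^-1 *: 1%:M) => //=; split.
  by apply/symmetricmxP; rewrite trmxZ trmx1.
by rewrite normFZ ger0_norm ?invr_ge0 1?ltW // mulVf ?gt_eqF.
Qed.

(** Optimality of [S] along the segment to [S'] makes the residual [rho] have a nonnegative inner
    product with [D], so [rho + D] is at least as long as [D]. *)
Lemma compressed_solution_nonexpansive (r : nat) (V : 'M[R]_(n, r)) (S S' : 'M[R]_r) :
  compressed_solution A b V S -> psd S' ->
  normF (compress A V (S' - S)) <= normF (compress A V S' - b).
Proof.
move=> [pS Smin] pS'.
have cB : compress A V (S' - S) = compress A V S' - compress A V S.
  by rewrite addrC -scaleN1r compress_linear scaleN1r addrC.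
set D := compress A V (S' - S); set rho := compress A V S - b.
have rD : compress A V S' - b = rho + D by rewrite /D cB /rho [RHS]addrC addrA subrK.
have ineq t : 0 <= t -> t <= 1 -> 0 <= 2 * t * \tr (rho^T *m D) + t ^+ 2 * normF D ^+ 2.
  move=> t0 t1; have pSt : psd (S + t *: (S' - S)).
    have -> : S + t *: (S' - S) = (1 - t) *: S + t *: S'.
      by rewrite scalerBr scalerBl scale1r addrA addrAC.
    by apply: psdD; apply: psdZ => //; rewrite subr_ge0.
  have := Smin _ pSt; rewrite /compressed_objective ler_pM2l ?invr_gt0 //.
  have -> : compress A V (S + t *: (S' - S)) - b = rho + t *: D.
    by rewrite [S + _]addrC compress_linear [X in X - b]addrC addrAC.
  rewrite -/rho [leRHS]normF_sqrD -addrA lerDl normFZ ger0_norm // exprMn.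
  by rewrite -scalemxAr mxtraceZ mulrA.
apply: normF_leP; first exact: normF_ge0.
rewrite rD normF_sqrD.
suff : 0 <= \tr (rho^T *m D).
  by have := sqr_ge0 (normF rho); lra.
rewrite leNgt; apply/negP => tneg.
set c := \tr _ in tneg ineq; set q := normF D ^+ 2 in ineq.
have q0 : 0 <= q by apply: sqr_ge0.
(* A step so short that [t ^+ 2 * q] is at most [- t * c]; then [2 * t * c + t ^+ 2 * q] is at most
   [t * c], which is negative. *)
pose t := Num.min 1 (- c / (q + 1)).
have t0 : 0 < t by rewrite lt_min ltr01 divr_gt0 // ?oppr_gt0 // ltr_wpDl.
have := ineq t (ltW t0); rewrite ge_min lexx /= => /(_ isT).
have : t * (q + 1) <= - c by rewrite -ler_pdivlMr ?ltr_wpDl // ge_min lexx orbT.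
by nra.
Qed.

Lemma slack_trace (X : 'M[R]_n) (y : 'cV[R]_m) : calA A X = b ->
  \tr (slack A C y *m X) = \tr (C *m X) - dot b y.
Proof. by move=> AX; rewrite mulmxBl mxtraceB calAT_adjoint AX. Qed.

End SemidefiniteProgram.

(** * Orthonormal bases of the range of a symmetric matrix *)

Section RangeBases.
Set Implicit Arguments.
Unset Strict Implicit.
Variable R : realType.

(** [V] is obtained as the complement of a complement: [U] spans the orthogonal complement of the
    range of [X], and [V] that of [U]. *)
Lemma range_basis_exists (n r : nat) (X : 'M[R]_n) : X^T = X -> \rank X = r ->
  exists V : 'M[R]_(n, r), orthonormal_cols V /\ V *m V^T *m X = X.
Proof.
move=> Xs rX; have En : n = (r + (n - r))%N by rewrite subnKC // -rX rank_leq_col.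
move: (n - r)%N En => k En; subst n.
have [|U [UU XU]] := @orthonormal_extension R _ _ k X; first by rewrite rX.
have [|V [VV UV]] := @orthonormal_extension R _ _ r U.
  by rewrite addnC leq_add2l rank_leq_col.
exists V; split=> //.
have VU : V^T *m U = 0 by apply: trmx_inj; rewrite trmx_mul trmxK UV trmx0.
have := complement_projector VV UU VU.
move/(congr1 (fun P => X - P *m X)); rewrite mulmxBl mul1mx opprB addrC subrK => ->.
by rewrite -mulmxA -{2}Xs -trmx_mul -Xs XU trmx0 mulmx0 subr0.
Qed.

(** The two bases differ by the square orthogonal factor [O], which cancels in the projector. *)
Lemma range_basis_projector (n r : nat) (X : 'M[R]_n) (V W : 'M[R]_(n, r)) :
  orthonormal_cols V -> V *m V^T *m X = X -> range_basis X W ->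
  W *m W^T = V *m V^T.
Proof.
move=> VV VX [WW /eqmxP WX].
have VW : V *m V^T *m W = W.
  have /submxP[D WD] : (W^T <= X^T)%MS by rewrite WX.
  by rewrite -[W]trmxK WD trmx_mul trmxK mulmxA VX.
pose O := V^T *m W.
have OO : O^T *m O = 1%:M by rewrite /O trmx_mul trmxK mulmxA -[_ *m V *m _]mulmxA -mulmxA VW WW.
have WE : W = V *m O by rewrite /O mulmxA VW.
by rewrite WE trmx_mul mulmxA -[_ *m O *m _]mulmxA (mulmx1C OO) mulmx1.
Qed.

Lemma psd_range_compression (n r : nat) (X : 'M[R]_n) (V : 'M[R]_(n, r)) :
  psd X -> V *m V^T *m X = X -> \rank X = r ->
  X = V *m (V^T *m X *m V) *m V^T /\ V^T *m X *m V \in unitmx.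
Proof.
move=> pX VX rX.
have XE : X = V *m (V^T *m X *m V) *m V^T.
  rewrite !mulmxA VX -mulmxA; apply: trmx_inj.
  by rewrite !trmx_mul trmxK (psd_sym pX) VX.
split=> //; rewrite -row_full_unit -col_leq_rank -[X in (X <= _)%N]rX {1}XE.
by rewrite (leq_trans (mxrankM_maxl _ _)) ?mxrankM_maxr.
Qed.

End RangeBases.

(** * Complementarity, nondegeneracy and primal uniqueness *)

Section Nondegeneracy.
Set Implicit Arguments.
Unset Strict Implicit.
Variables (R : realType) (n m r : nat).
Variables (A : 'I_m -> 'M[R]_n) (b : 'cV[R]_m) (C : 'M[R]_n).
Variables (hdata : sdp_data A C) (hreg : regular A b C).
Variables (X : 'M[R]_n) (y : 'cV[R]_m) (V : 'M[R]_(n, r)).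
Variables (hX : primal_solution A b C X) (hy : dual_solution A b C y).
Variables (VV : orthonormal_cols V) (VX : V *m V^T *m X = X) (rX : \rank X = r).
Local Notation Z := (slack A C y).
Local Notation P := (V *m V^T).

Lemma calAT_sym (z : 'cV[R]_m) : (calAT A z)^T = calAT A z.
Proof.
rewrite /calAT raddf_sum; apply: eq_bigr => i _ /=.
by rewrite trmxZ; case: hdata => /(_ i) /symmetricmxP ->.
Qed.

Lemma complementary_slackness (X' : 'M[R]_n) :
  primal_solution A b C X' -> Z *m X' = 0.
Proof.
move=> hX'; apply: trmul_psd_eq0; [exact: hy.1 | exact: hX'.1.2 |].
rewrite (slack_trace _ _ hX'.1.1); case: hreg => _ _ sd _.
by rewrite (sd _ _ hX' hy) subrr.
Qed.

(** Write [X] as [V S V^T] with [S] invertible and cancel [S] in [Z *m X = 0]. *)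
Lemma slack_mul_basis : Z *m V = 0.
Proof.
have [XE uS] := psd_range_compression hX.1.2 VX rX.
move: (V^T *m X *m V) XE uS => S XE uS.
have := complementary_slackness hX; rewrite XE => /(congr1 (mulmx^~ V)).
rewrite mul0mx !mulmxA -[_ *m V^T *m V]mulmxA VV mulmx1.
by move/(congr1 (mulmx^~ (invmx S))); rewrite mul0mx mulmxK.
Qed.

Lemma slack_smallest_eigenbasis : (r < n)%N ->
  smallest_eigenbasis Z V /\ 0 < lambda (n - r) Z.
Proof.
move=> rn; apply: kernel_smallest_eigenbasis => //; first exact: hy.1.
  exact: slack_mul_basis.
by case: hreg => _ _ _ /(_ _ _ hX hy); rewrite rX.
Qed.

Lemma slack_ge : (r < n)%N -> psd (Z - lambda (n - r) Z *: (1%:M - P)).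
Proof.
by move=> rn; apply: smallest_eigenbasis_psd (slack_smallest_eigenbasis rn).1; [|exact: hy.1].
Qed.

(* Uniqueness of the dual solution excludes feasible directions along the optimal face. *)
Lemma dual_nondegenerate (d : 'cV[R]_m) : (r < n)%N ->
  calAT A d *m P = 0 -> calAT A d = 0.
Proof.
move=> rn; set H := calAT A d => HP; have Hs : H^T = H by exact: calAT_sym.
have [-> //|H0] := eqVneq H 0; have nH := normF_gt0 H0.
have [_ l0] := slack_smallest_eigenbasis rn.
have pZ := slack_ge rn; set l := lambda (n - r) Z in l0 pZ.
have pN := projectorC (projector_cols VV).
set N := 1%:M - P in pZ pN.
(* With this step [t *: H] has norm [l], so [l%:M - t *: H] stays positive semidefinite. *)
pose t := l / normF H; have t0 : 0 < t by rewrite divr_gt0.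
have HN : N *m H *m N = H.
  have PH : P *m H = 0.
    apply: trmx_inj; rewrite trmx_mul Hs (projector_cols VV).1 trmx0.
    exact: HP.
  by rewrite /N mulmxBl PH mul1mx subr0 mulmxBr mulmx1 HP subr0.
clearbody N.
have feas : dual_feasible A C (y + t *: d).
  have E : slack A C (y + t *: d) = (Z - l *: N) + N *m (l%:M - t *: H) *m N.
    rewrite mulmxBr mulmxBl -scalemxAr -scalemxAl HN mul_mx_scalar -scalemxAl pN.2.
    by rewrite addrA subrK /slack calAT_scaleD opprD addrA.
  rewrite /dual_feasible E; apply: psdD => //.
  have := @psd_conj R _ _ (l%:M - t *: H) N; rewrite pN.1; apply.
  apply: psd_scalar_sub; first by rewrite trmxZ Hs.
  by rewrite normFZ ger0_norm ?(ltW t0) // /t divfK ?gt_eqF.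
(* The objective is constant along [d], since [b^T d = tr (H X) = tr (H P X)] and [H P = 0]. *)
have bd : dot b d = 0.
  rewrite -hX.1.1 -calAT_adjoint -/H -VX mulmxA [H *m _]HP mul0mx mxtrace0.
  by [].
have sol : dual_solution A b C (y + t *: d).
  split=> // z fz; apply: le_trans (hy.2 z fz) _.
  by rewrite [leRHS]dot_tr mulmxDr mxtraceD -scalemxAr mxtraceZ -!dot_tr bd mulr0 addr0.
case: hreg => _ [y' [_ yu]] _ _.
have : y + t *: d = y by rewrite -(yu _ sol) -(yu _ hy).
move/(canRL (addKr _)); rewrite addNr => /eqP; rewrite scaler_eq0 gt_eqF //= => /eqP d0.
by rewrite /H d0 /calAT big1 // => i _; rewrite mxE scale0r.
Qed.

(* Otherwise the line X + t W meets the boundary of the face of X at a primal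
   solution of smaller rank, against strict complementarity. *)
Lemma primal_nondegenerate (W : 'M[R]_n) :
  W^T = W -> P *m W *m P = W -> calA A W = 0 -> W = 0.
Proof.
move=> Ws PW AW; apply/eqP; case: eqVneq => // W0; exfalso.
have [XE uS] := psd_range_compression hX.1.2 VX rX.
set S := V^T *m X *m V in XE uS; have pS : psd S := psd_conj V hX.1.2.
pose G := V^T *m W *m V.
have WE : W = V *m G *m V^T by rewrite -[LHS]PW /G !mulmxA.
have Gs : G^T = G by rewrite /G !trmx_mul trmxK Ws mulmxA.
have G0 : G != 0 by apply: contraNneq W0 => G0; rewrite WE G0 mulmx0 mul0mx.
have [t pt ut] := psd_line_singular pS uS Gs G0.
have E : X + t *: W = V *m (S + t *: G) *m V^T.
  by rewrite mulmxDr mulmxDl -scalemxAr -scalemxAl -WE -XE.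
have sol : primal_solution A b C (X + t *: W).
  split.
    split; last by rewrite E; apply: psd_conj'.
    by rewrite calAD calAZ AW scaler0 addr0 hX.1.1.
  move=> X' fX'; apply: le_trans (hX.2 X' fX').
  (* As [calA A W = 0], [C] may be replaced by [Z], which annihilates [V]. *)
  have trCW : \tr (C *m W) = 0.
    have : \tr (Z *m W) = 0.
      by rewrite WE !mulmxA slack_mul_basis !mul0mx mxtrace0.
    rewrite mulmxBl mxtraceB calAT_adjoint AW /dot trmx0 mul0mx mxE.
    by rewrite subr0.
  by rewrite mulmxDr mxtraceD -scalemxAr mxtraceZ trCW mulr0 addr0.
case: hreg => _ _ _ sc.
(* Strict complementarity forces the new solution to have rank [r], although its [r]-by-[r] factor
   is singular. *)
have /addIn := etrans (sc _ _ hX hy) (esym (sc _ _ sol hy)); rewrite rX E => rk.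
have := leq_trans (mxrankM_maxl (V *m (S + t *: G)) V^T) (mxrankM_maxr V (S + t *: G)).
by rewrite -rk col_leq_rank row_full_unit (negbTE ut).
Qed.

(** [Z *m X' = 0] and the lower bound [slack_ge] on [Z] confine [X'] to the range of [P];
    [primal_nondegenerate] then applies to the difference. *)
Lemma primal_solution_unique (X' : 'M[R]_n) : (r < n)%N ->
  primal_solution A b C X' -> X' = X.
Proof.
move=> rn hX'; have pN := projectorC (projector_cols VV).
have [_ l0] := slack_smallest_eigenbasis rn.
have NX : (1%:M - P) *m X' = 0.
  apply: trmul_psd_eq0; [exact: projector_psd | exact: hX'.1.2 |].
  apply/le_anti/andP; split; last first.
    by apply: trmul_psd_ge0; [exact: projector_psd | exact: hX'.1.2].
  have := trmul_psd_ge0 (slack_ge rn) hX'.1.2.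
  rewrite mulmxBl (complementary_slackness hX') sub0r mxtraceN -scalemxAl mxtraceZ.
  by rewrite oppr_ge0 pmulr_rle0.
have PX' : P *m X' = X' by apply/esym/eqP; rewrite -subr_eq0 -{1}[X']mul1mx -mulmxBl NX.
have symP (Y : 'M[R]_n) : Y^T = Y -> P *m Y = Y -> P *m Y *m P = Y.
  move=> Ys PY; rewrite PY; apply: trmx_inj.
  by rewrite trmx_mul (projector_cols VV).1 Ys PY.
have Xs := psd_sym hX.1.2; have X's := psd_sym hX'.1.2.
apply/eqP; rewrite -subr_eq0; apply/eqP/primal_nondegenerate.
- by rewrite trmxB Xs X's.
- by rewrite mulmxBr mulmxBl !symP.
- by rewrite calAB hX.1.1 hX'.1.1 subrr.
Qed.

End Nondegeneracy.

(** * Comparison of nearby subspaces of equal dimension *)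

Section Perturbation.
Set Implicit Arguments.
Unset Strict Implicit.
Variables (R : realType) (n m r : nat).
Variables (A : 'I_m -> 'M[R]_n) (b : 'cV[R]_m) (C : 'M[R]_n).

Lemma normF_orthonormal_conj (V : 'M[R]_(n, r)) (S : 'M[R]_r) :
  orthonormal_cols V -> normF (V *m S *m V^T) = normF S.
Proof.
move=> VV; apply/eqP; rewrite -(@eqrXn2 _ 2) ?normF_ge0 //; apply/eqP.
rewrite !normF_sqr !trmx_mul trmxK !mulmxA mxtrace_mulC !mulmxA VV mul1mx.
by rewrite -[S^T *m V^T *m V]mulmxA VV mulmx1.
Qed.

Lemma orthonormal_basis_trace (V : 'M[R]_(n, r)) :
  orthonormal_cols V -> \tr (V *m V^T) = r%:R.
Proof. by move=> VV; rewrite mxtrace_mulC VV mxtrace1. Qed.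

(** Both projectors have trace [r], so both sides equal [r] minus the trace of their product. *)
Lemma normF_projector_gap (V W : 'M[R]_(n, r)) :
  orthonormal_cols V -> orthonormal_cols W ->
  normF ((1%:M - V *m V^T) *m (W *m W^T)) ^+ 2 = \tr ((1%:M - W *m W^T) *m (V *m V^T)).
Proof.
move=> VV WW; have tV := orthonormal_basis_trace VV; have tW := orthonormal_basis_trace WW.
have pV := projector_cols VV; have pW := projector_cols WW.
have pN := projectorC pV.
rewrite normF_sqr trmx_mul pN.1 pW.1 mulmxA -[_ *m _ *m (1%:M - _)]mulmxA pN.2.
rewrite mxtrace_mulC mulmxA pW.2 mulmxBr mulmxBl mulmx1 mul1mx !mxtraceB tV tW.
by [].
Qed.

(** [H = W S W^T] is within [2 * g * normF H] of [P H P]. The bound by [sigma_min A V] applies to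
    [P H P], and [sigma_max A] controls the image of the difference. *)
Lemma compress_perturbation (V W : 'M[R]_(n, r)) (S : 'M[R]_r) (g : R) :
  (0 < n)%N -> 0 <= sigma_min A V ->
  orthonormal_cols V -> orthonormal_cols W -> S^T = S ->
  normF ((1%:M - V *m V^T) *m (W *m W^T)) <= g ->
  sigma_min A V * normF (W *m S *m W^T) <=
    normF (compress A W S) + 2 * g * (sigma_max A + sigma_min A V) * normF (W *m S *m W^T).
Proof.
move=> n0 s0 VV WW Ss gap.
have pV := projector_cols VV; have pW := projector_cols WW.
have pN := projectorC pV.
set P := V *m V^T in pV pN gap *; set Q := W *m W^T in pW gap.
set N := 1%:M - P in pN gap.
set H := W *m S *m W^T.
have Hs : H^T = H by rewrite /H !trmx_mul trmxK Ss mulmxA.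
have QH : Q *m H = H.
  by rewrite /Q /H !mulmxA -[W *m W^T *m W]mulmxA WW mulmx1.
have NH : normF (N *m H) <= g * normF H.
  rewrite -{1}QH mulmxA; apply: le_trans (normFM _ _) _.
  by apply: ler_wpM2r; rewrite ?normF_ge0.
have HN : normF (H *m N) <= g * normF H.
  by rewrite -normF_tr trmx_mul Hs pN.1.
have HE : H = P *m H *m P + (N *m H + P *m (H *m N)).
  rewrite /N mulmxBl mul1mx !mulmxBr mulmx1 mulmxA.
  by rewrite [X in _ + X]addrA (subrK (P *m H)) [RHS]addrC (subrK (P *m H *m P)).
have diff : normF (N *m H + P *m (H *m N)) <= 2 * g * normF H.
  apply: le_trans (normFD _ _) _.
  have := normF_projl (H *m N) pV; lra.
have low : normF H <= normF (P *m H *m P) + 2 * g * normF H.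
  by rewrite {1}HE; apply: le_trans (normFD _ _) _; rewrite lerD2l.
have up : normF (calA A (P *m H *m P)) <= normF (compress A W S) + sigma_max A * (2 * g * normF H).
  have -> : calA A (P *m H *m P) = calA A H - calA A (N *m H + P *m (H *m N)).
    by rewrite -calAB {2}HE addrK.
  apply: le_trans (normFB _ _) _; rewrite lerD2l.
  apply: le_trans (calA_le _ _) _; apply: ler_wpM2l => //; exact: sigma_max_ge0.
have mid : sigma_min A V * normF (P *m H *m P) <= normF (calA A (P *m H *m P)).
  have Gs : (V^T *m H *m V)^T = V^T *m H *m V.
    by rewrite trmx_mul (trmx_mul V^T H) trmxK Hs mulmxA.
  have := @sigma_min_le R n m A r V _ Gs.
  have E : V *m (V^T *m H *m V) *m V^T = P *m H *m P by rewrite /P !mulmxA.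
  by rewrite /compress E -(normF_orthonormal_conj _ VV) E.
have := ler_wpM2l s0 low; rewrite mulrDr => h.
apply: le_trans h _; lra.
Qed.

Lemma sigma_min_ge0 (V : 'M[R]_(n, r)) : 0 <= sigma_min A V.
Proof.
(* For [r = 0] the only matrix has norm 0, so the index set is empty and the infimum takes its
   default value 0. *)
have [r0|] := posnP r; last first.
  by move/sigma_min_ge; apply => S _; rewrite mul0r normF_ge0.
rewrite /sigma_min; set B := (X in inf X).
suff -> : B = set0 by rewrite inf0.
apply/seteqP; split=> // x [S /= [_ S1] _].
have S0 : S = 0 by apply/matrixP => i; have := ltn_ord i; rewrite [in X in (_ < X)%N]r0.
by have := oner_neq0 R; rewrite -S1 S0 normF0 eqxx.
Qed.

(** It turns a bound on the trace against [X] into one on the trace against the projector. *)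
Lemma psd_range_ge (X : 'M[R]_n) (V : 'M[R]_(n, r)) :
  psd X -> V *m V^T *m X = X -> \rank X = r ->
  exists2 s, 0 < s & psd (X - s *: (V *m V^T)).
Proof.
move=> pX VX rX; have [XE uS] := psd_range_compression pX VX rX.
have [s s0 pSs] := psd_unit_ge (psd_conj V pX) uS; exists s => //.
have -> : X - s *: (V *m V^T) = V *m (V^T *m X *m V - s%:M) *m V^T.
  by rewrite mulmxBr mulmxBl mul_mx_scalar -scalemxAl -XE.
exact: psd_conj'.
Qed.

End Perturbation.

(** * Stability of the slack matrix, and injectivity of the operator on the optimal face *)

Section Stability.
Set Implicit Arguments.
Unset Strict Implicit.
Variables (R : realType) (n m r : nat).
Variables (A : 'I_m -> 'M[R]_n) (b : 'cV[R]_m) (C : 'M[R]_n).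
Variables (hdata : sdp_data A C) (hreg : regular A b C).
Variables (X : 'M[R]_n) (y : 'cV[R]_m) (V : 'M[R]_(n, r)).
Variables (hX : primal_solution A b C X) (hy : dual_solution A b C y).
Variables (VV : orthonormal_cols V) (VX : V *m V^T *m X = X) (rX : \rank X = r).
Variable rn : (r < n)%N.
Local Notation Z := (slack A C y).
Local Notation P := (V *m V^T).

Lemma suboptimality_trace (y' : 'cV[R]_m) :
  \tr (slack A C y' *m X) = dot b y - dot b y'.
Proof.
by rewrite (slack_trace _ _ hX.1.1); case: hreg => _ _ /(_ _ _ hX hy) -> _.
Qed.

(* The bound on [D] is quadratic in [normF D] on the left and affine on the
   right, so a small suboptimality forces [D] to be small. *)
Lemma slack_close (tau : R) : 0 < tau ->
  exists2 c : R, 0 < c & forall y', dual_feasible A C y' ->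
    dot b y - dot b y' < c -> normF (slack A C y' - Z) <= tau.
Proof.
move=> tau0; have pP := projector_cols VV.
have [s s0 pXs] := psd_range_ge hX.1.2 VX rX.
have [K K0 HK] : exists2 K, 0 < K & forall d,
    normF (calAT A d) <= K * normF (calAT A d *m P).
  apply: linear_kernel_bound.
  - by move=> a u v; rewrite calAT_linear mulmxDl -scalemxAl.
  - exact: calAT_linear.
  - by move=> d; apply: dual_nondegenerate hX hy VV VX rX _ rn.
pose z := normF Z; have z0 : 0 <= z by apply: normF_ge0.
(* Chosen for the contradiction below: for [t > tau], [z + t] is at most [(z / tau + 1) * t], and
   [s * t ^+ 2 <= K ^+ 2 * (z + t) * eps] then fails for [eps < c]. *)
pose c := s * tau / (K ^+ 2 * (z / tau + 1)).
have k0 : 0 < K ^+ 2 * (z / tau + 1).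
  by rewrite mulr_gt0 ?exprn_gt0 // ltr_wpDl ?divr_ge0 // ltW.
have c0 : 0 < c by rewrite divr_gt0 // mulr_gt0.
exists c => // y' fy' ec; set D := _ - Z; set eps := _ - _ in ec.
have DE : D = calAT A (y - y').
  have := calAT_linear A (-1) y' y; rewrite !scaleN1r [X in calAT A X]addrC => ->.
  by rewrite /D /slack opprB [LHS]addrC addrA subrK addrC.
have ZV := slack_mul_basis hreg hX hy VV VX rX.
have DP : D *m P = slack A C y' *m P by rewrite mulmxBl [Z *m P]mulmxA ZV mul0mx subr0.
(* [X - s *: P] is positive semidefinite, and the trace of the slack matrix against [X] is [eps]. *)
have trP : s * \tr (P^T *m slack A C y' *m P) <= eps.
  rewrite pP.1 mxtrace_mulC mulmxA pP.2.
  have := trmul_psd_ge0 pXs fy'.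
  rewrite mulmxBl mxtraceB subr_ge0 -scalemxAl mxtraceZ => /le_trans; apply.
  by rewrite mxtrace_mulC suboptimality_trace.
have nZ' : normF (slack A C y') <= z + normF D.
  have -> : slack A C y' = Z + D by rewrite /D addrC subrK.
  exact: normFD.
set t := normF D in nZ' *.
have t0 : 0 <= t by apply: normF_ge0.
have q0 : 0 <= \tr (P^T *m slack A C y' *m P) by apply/psd_mxtrace_ge0/psd_conj.
set q := \tr _ in trP q0.
have DPq : normF (D *m P) ^+ 2 <= (z + t) * q.
  rewrite DP; apply: le_trans (normF_psd_mul_sqr_le _ fy') _.
  by apply: ler_wpM2r => //; apply: le_trans (normop_le_normF _) nZ'.
have tK : t ^+ 2 <= K ^+ 2 * ((z + t) * q).
  have := HK (y - y'); rewrite -DE -/t => h.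
  apply: le_trans (_ : (K * normF (D *m P)) ^+ 2 <= _).
    by rewrite ler_sqr ?nnegrE // mulr_ge0 ?normF_ge0 // ltW.
  by rewrite exprMn ler_wpM2l ?sqr_ge0.
rewrite leNgt; apply/negP => taut.
have t1 : 0 < t by apply: lt_trans taut.
have zt : z + t <= (z / tau + 1) * t.
  rewrite mulrDl mul1r lerD2r mulrAC ler_pdivlMr //.
  by apply: ler_wpM2l => //; apply: ltW.
have : s * t ^+ 2 < s * tau * t.
  apply: le_lt_trans (_ : K ^+ 2 * ((z / tau + 1) * t) * eps < _).
    apply: le_trans (_ : s * (K ^+ 2 * ((z + t) * q)) <= _); first by rewrite ler_pM2l.
    have -> : s * (K ^+ 2 * ((z + t) * q)) = (K ^+ 2 * (z + t)) * (s * q) by ring.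
    apply: ler_pM => //.
    - by rewrite mulr_ge0 ?sqr_ge0 ?addr_ge0.
    - by rewrite mulr_ge0 // ltW.
    - by rewrite ler_wpM2l ?sqr_ge0.
  apply: (@le_lt_trans _ _ (eps * (K ^+ 2 * (z / tau + 1)) * t)); last first.
    by rewrite ltr_pM2r // -ltr_pdivlMr.
  by rewrite le_eqVlt; apply/orP; left; apply/eqP; ring.
rewrite expr2 -mulrA ltr_pM2l // ltr_pM2r // => tt.
by have := lt_trans tt taut; rewrite ltxx.
Qed.

Lemma compress_injective_bound :
  exists2 K, 0 < K & forall W, W^T = W -> P *m W *m P = W ->
    normF W <= K * normF (calA A W).
Proof.
have pP := projector_cols VV.
(* The kernel bound concerns maps on all matrices; [p] sends these into the symmetric matrices fixed
   by [P]-compression, and doubles the latter. *)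
pose p (W : 'M[R]_n) := P *m (W + W^T) *m P.
have lp : linear p.
  move=> a G H; rewrite /p trmxD trmxZ addrACA -scalerDr mulmxDr mulmxDl.
  by rewrite -scalemxAr -scalemxAl.
have [K K0 HK] : exists2 K, 0 < K & forall W, normF (p W) <= K * normF (calA A (p W)).
  apply: linear_kernel_bound => //.
    by move=> a G H; rewrite lp calA_linear.
  move=> W; apply: (primal_nondegenerate hreg hX hy VV VX rX).
    by rewrite /p !trmx_mul trmxK trmxD trmxK [W^T + _]addrC !mulmxA.
  exact: projector_sandwich.
exists K => // W Ws PW; have := HK W.
have -> : p W = 2 *: W by rewrite /p Ws -mulr2n -scaler_nat -scalemxAr -scalemxAl PW.
by rewrite (calAZ A 2 W) !normFZ mulrCA ler_pM2l // normr_gt0 pnatr_eq0.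
Qed.

End Stability.

(** * Error of the recovered matrix *)

Section InfeasibleRecovery.
Set Implicit Arguments.
Unset Strict Implicit.
Variables (R : realType) (n m r : nat).
Variables (A : 'I_m -> 'M[R]_n) (b : 'cV[R]_m) (C : 'M[R]_n).

(** Here [V] is the reference basis and [W] the computed one. The error splits into the projection
    error of [X] and [H]; the image of [H] has norm at most [sigma_max A * delta]. *)
Lemma recovery_error (X : 'M[R]_n) (V W : 'M[R]_(n, r)) (S : 'M[R]_r) (delta g K : R) :
  (0 < n)%N -> orthonormal_cols V -> orthonormal_cols W ->
  primal_feasible A b X -> compressed_solution A b W S ->
  normF (X - W *m W^T *m X *m (W *m W^T)) <= delta ->
  0 < K -> (forall H, H^T = H -> V *m V^T *m H *m (V *m V^T) = H ->
    normF H <= K * normF (calA A H)) ->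
  normF ((1%:M - V *m V^T) *m (W *m W^T)) <= g ->
  4 * g * (sigma_max A * K + 1) <= 1 ->
  normF (W *m S *m W^T - X) <= (1 + 2 * kappa A V) * delta.
Proof.
move=> n0 VV WW [AX pX] solS Xd K0 HK gap gK.
have g0 : 0 <= g by apply: le_trans gap; apply: normF_ge0.
have d0 : 0 <= delta by apply: le_trans Xd; apply: normF_ge0.
have s0 := sigma_min_ge0 A V; have M0 := sigma_max_ge0 A n0.
pose S' := W^T *m X *m W.
have pS' : psd S' by apply: psd_conj.
have WS' : W *m S' *m W^T = W *m W^T *m X *m (W *m W^T) by rewrite /S' !mulmxA.
rewrite -WS' in Xd.
have Ds : (S' - S)^T = S' - S by rewrite trmxB (psd_sym pS') (psd_sym solS.1).
have resid : normF (compress A W (S' - S)) <= sigma_max A * delta.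
  apply: le_trans (compressed_solution_nonexpansive solS pS') _.
  rewrite /compress -AX -calAB; apply: le_trans (calA_le _ _) _.
  by apply: ler_wpM2l => //; rewrite -normFN opprB.
set H := W *m (S' - S) *m W^T.
have main : normF H <= 2 * kappa A V * delta.
  (* For [r = 0], [sigma_min A V] is 0 and cannot be divided out, but [S' - S] is an empty
     matrix. *)
  have [r0|r0] := posnP r.
    have -> : normF H = 0.
      rewrite /H (normF_orthonormal_conj _ WW).
      have -> : S' - S = 0; last by rewrite normF0.
      by apply/matrixP => i; have := ltn_ord i; rewrite [X in (_ < X)%N]r0.
    by rewrite mulr_ge0 // mulr_ge0 // divr_ge0.
  have sK : 1 <= sigma_min A V * K.
    rewrite -ler_pdivrMr // mul1r; apply: sigma_min_ge => // G Gs.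
    rewrite mulrC ler_pdivrMr // mulrC -(normF_orthonormal_conj G VV).
    apply: HK; first by rewrite !trmx_mul trmxK Gs mulmxA.
    by rewrite !mulmxA -[V *m V^T *m V]mulmxA VV mulmx1 -[_ *m V^T *m V]mulmxA VV mulmx1.
  have sp : 0 < sigma_min A V.
    by rewrite lt_neqAle s0 andbT; apply: contraTneq sK => <-; rewrite mul0r -ltNge ltr01.
  have := compress_perturbation n0 s0 VV WW Ds gap; rewrite -/H.
  set h := normF H; have h0 : 0 <= h by apply: normF_ge0.
  set s := sigma_min A V in s0 sK sp *; set M := sigma_max A in M0 gK resid *.
  move=> pert.
  (* The perturbation term is thus at most half of [s * h]; absorbing it yields the factor 2 in
     front of [kappa]. *)
  have gs : 4 * g * (M + s) <= s.
    apply: le_trans (_ : s * (4 * g * (M * K + 1)) <= _); last first.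
      by rewrite -[leRHS]mulr1 ler_wpM2l.
    have -> : s * (4 * g * (M * K + 1)) = 4 * g * (M * (s * K) + s) by ring.
    by rewrite ler_wpM2l ?mulr_ge0 // lerD2r -[leLHS]mulr1 ler_wpM2l.
  have gsh : 4 * g * (M + s) * h <= s * h by rewrite ler_wpM2r.
  have -> : 2 * kappa A V * delta = 2 * (M * delta) / s by rewrite /kappa -/s -/M; ring.
  by rewrite ler_pdivlMr // mulrC; lra.
have -> : W *m S *m W^T - X = - (X - W *m S' *m W^T) - H.
  have -> : H = W *m S' *m W^T - W *m S *m W^T by rewrite /H mulmxBr mulmxBl.
  by rewrite !opprB [RHS]addrC addrA (subrK (W *m S' *m W^T)).
apply: le_trans (normFB _ _) _; rewrite normFN mulrDl mul1r.
exact: lerD.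
Qed.

End InfeasibleRecovery.

Theorem theorem4p1 (R : realType) (n m : nat)
    (A : 'I_m -> 'M[R]_n) (b : 'cV[R]_m) (C : 'M[R]_n)
    (hdata : sdp_data A C) (hreg : regular A b C) :
  exists c1 : R, 0 < c1 /\
    forall (Xs : 'M[R]_n) (ys : 'cV[R]_m) (r : nat) (Vs : 'M[R]_(n, r)),
      primal_solution A b C Xs -> dual_solution A b C ys ->
      r = \rank Xs -> (r < n)%N -> range_basis Xs Vs ->
    forall (y : 'cV[R]_m) (V : 'M[R]_(n, r)) (S : 'M[R]_r),
      let eps := dot b ys - dot b y in
      let Xinfeas := V *m S *m V^T in
      let T := lambda (n - r) (slack A C y) in
      dual_feasible A C y -> eps < c1 ->
      smallest_eigenbasis (slack A C y) V ->
      compressed_solution A b V S ->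
      [/\ 2^-1 * lambda (n - r) (slack A C ys) <= T,
          0 < 2^-1 * lambda (n - r) (slack A C ys) &
          normF (Xinfeas - Xs) <=
            (1 + 2 * kappa A Vs) *
            (eps / T + Num.sqrt (2 * (eps / T) * normop Xs))].
Proof.
case: (hreg) => -[X hX] [y0 [hy yuniq]] _ sc.
have rk (X' : 'M[R]_n) : primal_solution A b C X' -> \rank X' = \rank X.
  by move=> hX'; have /addIn := etrans (sc _ _ hX' hy) (esym (sc _ _ hX hy)).
(* All primal solutions have the rank of [X], so for full rank the condition [r < n] is never met
   and any constant works. *)
have [nr|rn] := leqP n (\rank X).
  exists 1; split=> // Xs ys r Vs hXs _ rE rn.
  by exfalso; move: rn; rewrite rE (rk _ hXs) ltnNge nr.
have [r rX] : exists r, \rank X = r by exists (\rank X).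
rewrite rX in rk rn.
have [V0 [VV0 VX0]] := range_basis_exists (psd_sym hX.1.2) rX.
have n0 : (0 < n)%N by apply: leq_ltn_trans rn.
have [eb l0] := slack_smallest_eigenbasis hreg hX hy VV0 VX0 rX rn.
set l := lambda (n - r) (slack A C y0) in l0.
have [s s0 pXs] := psd_range_ge hX.1.2 VX0 rX.
have [K K0 HK] := compress_injective_bound hreg hX hy VV0 VX0 rX.
have l20 : 0 < 2^-1 * l by rewrite mulr_gt0 // invr_gt0.
have [c c0 Hc] := slack_close hdata hreg hX hy VV0 VX0 rX rn l20.
have M0 := sigma_max_ge0 A n0.
have MK0 : 0 < sigma_max A * K + 1 by rewrite ltr_wpDl // mulr_ge0 // ltW.
(* The largest gap that [recovery_error] tolerates. *)
pose g := (4 * (sigma_max A * K + 1))^-1.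
have g0 : 0 < g by rewrite invr_gt0 mulr_gt0.
(* The first bound keeps the slack matrix within [l / 2] of the optimal one, so that [T >= l / 2].
   With this, the second bound makes [eps / T] at most [s * g ^+ 2], hence the gap at most [g]. *)
exists (Num.min c (s * (2^-1 * l) * g ^+ 2)); split.
  by rewrite lt_min c0 !mulr_gt0 ?exprn_gt0 // invr_gt0.
move=> Xs ys r' Vs hXs hys r'E r'n hVs y V S eps Xinf T fy epsc hV hS.
have E : Xs = X by apply: (primal_solution_unique hreg hX hy VV0 VX0 rX rn hXs).
have r'r : r' = r by rewrite r'E rk.
have E' : ys = y0 by rewrite -(yuniq _ hys).
clear r'E; subst r' Xs ys.
have eps_tr : \tr (slack A C y *m X) = eps := suboptimality_trace hreg hX hy y.
have eps0 : 0 <= eps by rewrite -eps_tr; apply: trmul_psd_ge0 fy hX.1.2.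
move: epsc; rewrite lt_min => /andP[epsc epsg].
have lT : 2^-1 * l <= T.
  (* [lambda] counts from 1, and [n - r] is positive. *)
  have := lambda_weyl (k := (n - r).-1) _ (psd_sym fy) (psd_sym hy.1).
  rewrite prednK ?subn_gt0 // leq_subr -/T -/l => /(_ isT).
  by have := Hc _ fy epsc; lra.
have T0 : 0 < T by apply: lt_le_trans lT.
split=> //.
have [VV _ _] := hV; have pV := projector_cols VV.
have VsE := range_basis_projector VV0 VX0 hVs.
have trN : \tr ((1%:M - V *m V^T) *m X) <= eps / T.
  rewrite ler_pdivlMr // mulrC -eps_tr.
  have := trmul_psd_ge0 (smallest_eigenbasis_psd rn fy hV) hX.1.2.
  by rewrite mulmxBl mxtraceB subr_ge0 -scalemxAl mxtraceZ.
have trgap : \tr ((1%:M - V *m V^T) *m (V0 *m V0^T)) <= g ^+ 2.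
  have := trmul_psd_ge0 (projector_psd (projectorC pV)) pXs.
  rewrite mulmxBr mxtraceB subr_ge0 -scalemxAr mxtraceZ => /le_trans/(_ trN).
  rewrite ler_pdivlMr // => h.
  have q0 : 0 <= \tr ((1%:M - V *m V^T) *m (V0 *m V0^T)).
    by apply: trmul_psd_ge0; apply: projector_psd; [apply: projectorC | apply: projector_cols].
  have sl0 : 0 < s * (2^-1 * l) by rewrite mulr_gt0.
  rewrite -(ler_pM2l sl0); apply: le_trans (ltW epsg).
  apply: le_trans h; rewrite mulrAC; apply: ler_wpM2l => //.
  by rewrite mulr_ge0 // ltW.
(* [K] and the gap were found for [V0]; they depend only on its projector, which is also that of the
   given basis of the range. *)
apply: (recovery_error (g := g) n0 hVs.1 VV hX.1 hS _ K0); rewrite ?VsE //.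
- exact: projection_error pV hX.1.2 trN.
- apply: normF_leP; first exact: ltW.
  by rewrite -VsE normF_projector_gap ?VsE //; exact: hVs.1.
by rewrite /g mulrAC divff // gt_eqF // mulr_gt0.
Qed.
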